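(* Let $\{\mathcal S_j\}_{j=1}^{n_s}$ be a dictionary of shapes in $D$, each a union of cells from a fixed finite collection of cells $\{\Omega_i\}_{i=1}^{n_\Omega}$, every cell being contained in at least one shape. Let $\mathcal I_\oplus=\{1,\dots,n_\oplus\}$, $\mathcal I_\ominus=\{n_\oplus+1,\dots,n_\oplus+n_\ominus\}$ with $n_\oplus\ge1$, $n_\ominus\ge0$, $n_\oplus+n_\ominus\le n_s$. Suppose $\mathcal R=\mathcal R_{\mathcal I_\oplus,\mathcal I_\ominus}$ is a basic non-redundant composition and $\Sigma=\mathrm{cl}(\mathcal R_{\mathcal I_\oplus,\mathcal I_\ominus})$ satisfies the lucid object condition. Let $B'$ and $B''$ be the binary matrices with columns indexed by $i\in\Gamma_0\cup\Gamma_1$ and entries $1_{\{\Omega_i\subset\mathcal S_j\}}$, with rows indexed by $j=1,\dots,n_\oplus+n_\ominus$ for $B'$ and by $j=n_\oplus+n_\ominus+1,\dots,n_s$ for $B''$. If the matrix $$\begin{bmatrix} B' \\ B'' \end{bmatrix}$$ has full row rank and $$\Big|\sum_{\ell\in\Gamma_0^{\mathcal R}\cup\Gamma_1^{\mathcal R}}\gamma_{\ell,j}\,w_\ell\Big|<1\qquad\text{for all }j\in\{n_\oplus+n_\ominus+1,\dots,n_s\},$$ then the unique minimizer of the convex program $$\min_{\alpha\in\mathbb R^{n_s}}\ G(\alpha)\quad\text{s.t.}\quad\|\alpha\|_1\le\|\alpha_{\mathcal R}\|_1$$ is the vector $\alpha^*$ with $\alpha^*_{\mathcal I_\oplus\cup\mathcal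 I_\ominus}=\alpha_{\mathcal R}$ and $\alpha^*_{(\mathcal I_\oplus\cup\mathcal I_\ominus)^c}=\mathbf 0$, where $\alpha_{\mathcal R}$ is the outcome of the linkage process for $\mathcal R_{\mathcal I_\oplus,\mathcal I_\ominus}$.
   Context: $D\subset\mathbb R^d$ is the imaging domain (an open set or the closure of an open set); closure, interior, boundary and complement ($\mathcal S^c=D\setminus\mathcal S$) are taken relative to $D$. $\Pi_{in},\Pi_{ex}:D\to[0,\infty)$ are fixed integrable functions. A shape is a closed set $\mathcal S\subset D$ with nonempty interior; boundary points and null sets are disregarded, in the sense that shapes and cells equal the closure of their interior and have Lebesgue-null boundary. $\mathcal L_\alpha(x)=\sum_{j=1}^{n_s}\alpha_j\chi_{\mathcal S_j}(x)$ ($\chi$ = characteristic function), and $G(\alpha)=\int_D\max\big((\Pi_{in}(x)-\Pi_{ex}(x))\mathcal L_\alpha(x),\ (\Pi_{in}(x)-\Pi_{ex}(x))^-\big)dx$ with $t^-=\min(t,0)$. Lucid object condition (LOC) for $\Sigma$: $\Pi_{in}(x)<\Pi_{ex}(x)$ for $x\in\Sigma$ and $\Pi_{in}(x)>\Pi_{ex}(x)$ for $x\in D\setminus\Sigma$. $\mathcal R_{\mathcal I_\oplus,\mathcal I_\ominus}=\big(\bigcup_{j\in\mathcal I_\oplus}\mathcal S_j\big)\setminus\big(\bigcup_{j\in\mathcal I_\ominus}\mathcal S_j\big)$; it is non-redundant if for every $j'\in\mathcal I_\oplus$, $\mathrm{int}(\mathcal R_{\mathcal I_\oplus\setminus\{j'\},\mathcal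 I_\ominus})\ne\mathrm{int}(\mathcal R_{\mathcal I_\oplus,\mathcal I_\ominus})$ and for every $j'\in\mathcal I_\ominus$, $\mathrm{int}(\mathcal R_{\mathcal I_\oplus,\mathcal I_\ominus\setminus\{j'\}})\neq\mathrm{int}(\mathcal R_{\mathcal I_\oplus,\mathcal I_\ominus})$. Disjoint shape decomposition (DSD) of $\{\mathcal S_j\}_{j\in\mathcal I}$: for nonzero $J\in\{0,1\}^{\mathcal I}$ put $\Omega_J=\bigcap_{j\in\mathcal I}\Theta_{J_j}(\mathcal S_j)$, where $\Theta_1(\mathcal S)=\mathcal S$, $\Theta_0(\mathcal S)=\mathrm{cl}(\mathcal S^c)$. The shapelets are the sets $\Omega_J$ with nonempty interior, with distinct constructor vectors $J^{(1)},J^{(2)},\dots$; the bearing matrix has $(\ell,j)$ entry $J^{(\ell)}_j$, and $\mathcal I_j=\{\ell:J^{(\ell)}_j=1\}$. Apply DSD to $\{\mathcal S_j\}_{j\in\mathcal I_\oplus\cup\mathcal I_\ominus}$, with shapelets $\Omega^{\mathcal R}_\ell$ and bearing matrix $B^{\mathcal R}$. Put $\mathcal N_\oplus=\bigcup_{j\in\mathcal I_\oplus}\mathcal I_j$, $\mathcal N_\ominus=\bigcup_{j\in\mathcal I_\ominus}\mathcal I_j$. Let $B^{(1,1)}$ be the submatrix of $B^{\mathcal R}$ with rows $\mathcal N_\oplus\setminus\mathcal N_\ominus$ and columns $\mathcal I_\oplus$; $B^{(2,1)},B^{(2,2)}$ those with rows $\mathcal N_\ominus$ and columns $\mathcal I_\oplus$,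 resp. $\mathcal I_\ominus$. Consider (LP): $\max\mathbf 1^T\alpha_{\mathcal I_\ominus}$ s.t. $B^{(2,2)}\alpha_{\mathcal I_\ominus}\preceq-B^{(2,1)}\mathbf 1$. Unit-valued shapelets: $\Gamma_1^{\mathcal R}=\{\ell\in\mathcal N_\oplus\setminus\mathcal N_\ominus:B^{(1,1)}_{\ell,:}\mathbf 1=1\}$. Null-valued shapelets, for a maximizer $\alpha^\dagger_{\mathcal I_\ominus}$ of (LP): $\Gamma_0^{\mathcal R}=\{\ell\in\mathcal N_\ominus:B^{(2,2)}_{\ell,:}\alpha^\dagger_{\mathcal I_\ominus}+B^{(2,1)}_{\ell,:}\mathbf 1=0\}$; $\Delta_{\mathcal R}=B^{(2,2)}_{\Gamma_0^{\mathcal R},:}$. A non-redundant composition is basic if, for a maximizer of (LP), $\mathrm{rank}(\Delta_{\mathcal R})=|\mathcal I_\ominus|=|\Gamma_0^{\mathcal R}|$ and the solution $v$ of $\Delta_{\mathcal R}^Tv=\mathbf 1$ is entrywise strictly positive; then the maximizer of (LP) is unique. The outcome $\alpha_{\mathcal R}\in\mathbb R^{n_\oplus+n_\ominus}$ of the linkage process has entries $1$ on $\mathcal I_\oplus$ and equals the maximizer of (LP) on $\mathcal I_\ominus$. Bearing constants: $w=(w_\ell)_{\ell\in\Gamma_0^{\mathcal R}\cup\Gamma_1^{\mathcal R}}$ is the unique solution of $\big(B^{\mathcal R}_{\Gamma_0^{\mathcal R}\cup\Gamma_1^{\mathcal R},:}\big)^Tw=-\bar c$, where $\bar c\in\mathbb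 R^{n_\oplus+n_\ominus}$ has entries $1$ on $\mathcal I_\oplus$ and $-1$ on $\mathcal I_\ominus$. Cells: $\{\Omega_i\}_{i=1}^{n_\Omega}$ are closed sets with nonempty interior, pairwise disjoint up to null sets. $\mathcal J_\ell=\{i:\Omega_i\subset\Omega^{\mathcal R}_\ell\}$, so that $\Omega^{\mathcal R}_\ell=\bigcup_{i\in\mathcal J_\ell}\Omega_i$ (up to null sets). $T$ is the set of indices $i$ of the cells lying (up to null sets) in $\big(\bigcup_{j=1}^{n_s}\mathcal S_j\big)\setminus\big(\bigcup_{j=1}^{n_\oplus+n_\ominus}\mathcal S_j\big)$. Put $\Gamma_0=T\cup\bigcup_{\ell\in\Gamma_0^{\mathcal R}}\mathcal J_\ell$ and $\Gamma_1=\bigcup_{\ell\in\Gamma_1^{\mathcal R}}\mathcal J_\ell$. For $\ell\in\Gamma_0^{\mathcal R}\cup\Gamma_1^{\mathcal R}$ and $j\in\{n_\oplus+n_\ominus+1,\dots,n_s\}$, $$\gamma_{\ell,j}=\frac1{|\mathcal J_\ell|}\sum_{i\in\mathcal J_\ell}1_{\{\Omega_i\subset\mathcal S_j\}}.$$ *)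

(* Defs.v *)
From HB Require Import structures.
From mathcomp Require Import all_boot all_order all_algebra.
From mathcomp Require Import all_classical all_reals all_analysis.

Set Implicit Arguments.
Unset Strict Implicit.
Unset Printing Implicit Defensive.

Import Order.TTheory GRing.Theory Num.Theory.
Import numFieldNormedType.Exports.

Local Open Scope classical_set_scope.
Local Open Scope ring_scope.

Section LebesgueMeasure.
Variables (R : realType) (d : nat).
Local Notation V := 'rV[R]_d.+1.

Definition box (a b : V) : set V :=
  [set x | forall i, a 0 i < x 0 i <= b 0 i].

Definition box_vol (a b : V) : R := \prod_i Num.max 0 (b 0 i - a 0 i).

(* The dimension is a successor so that empty boxes exist. *)
Definition leb_outer (A : set V) : \bar R :=
  ereal_inf [set (\sum_(k <oo) (box_vol (F k).1 (F k).2)%:E)%E |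
    F in [set F : nat -> V * V | A `<=` \bigcup_k box (F k).1 (F k).2]].

Lemma box_vol_ge0 a b : 0 <= box_vol a b.
Proof. by apply: prodr_ge0 => i _; rewrite le_max lexx. Qed.

Lemma box_volE_ge0 (p : V * V) : (0 <= (box_vol p.1 p.2)%:E)%E.
Proof. by rewrite lee_fin box_vol_ge0. Qed.

Lemma leb_outer_ge0 A : (0 <= leb_outer A)%E.
Proof.
apply: le_ereal_inf_tmp => _ [F _ <-].
by apply: nneseries_ge0 => n _ _; exact: box_volE_ge0.
Qed.

Lemma leb_outer0 : leb_outer set0 = 0%E.
Proof.
apply/eqP; rewrite eq_le leb_outer_ge0 andbT.
apply: ereal_inf_lbound; exists (fun=> (0, 0)) => //=.
rewrite eseries0// => n _ _; rewrite /box_vol big_ord_recl.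
by rewrite subrr maxxx mul0r.
Qed.

Lemma le_leb_outer : {homo leb_outer : A B / A `<=` B >-> (A <= B)%E}.
Proof.
move=> A B AB; apply/ereal_inf_le_tmp => _ [F BF <-].
by exists F => //; exact: subset_trans BF.
Qed.

Lemma leb_outer_sigma_subadditive : sigma_subadditive leb_outer.
Proof.
move=> A; have [[i ioo]|] := pselect (exists i, leb_outer (A i) = +oo%E).
  rewrite (eseries_pinfty _ _ ioo) ?leey// => n _.
  by rewrite -ltNye (lt_le_trans _ (leb_outer_ge0 _)).
rewrite -forallNE => Aoo.
pose vol (p : V * V) := (box_vol p.1 p.2)%:E.
have vol_ge0 p : (0 <= vol p)%E by exact: box_volE_ge0.
suff add2e (e : {posnum R}) :
    (leb_outer (\bigcup_n A n) <=
     \sum_(i <oo) leb_outer (A i) + e%:num%:E)%E.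
  by apply/lee_addgt0Pr => _/posnumP[].
rewrite (le_trans _ (epsilon_trick _ _ _))//; last first.
  by move=> n; exact: leb_outer_ge0.
pose P n (B : nat -> V * V) := A n `<=` \bigcup_k box (B k).1 (B k).2 /\
  (\sum_(k <oo) vol (B k) <=
   leb_outer (A n) + (e%:num / (2 ^ n.+1)%:R)%:E)%E.
have [G PG] : {G : nat -> nat -> V * V & forall n, P n (G n)}.
  apply: (@choice _ _ P) => n; rewrite /P /leb_outer.
  set S := (X in ereal_inf X); move infS : (ereal_inf S) => iS.
  case: iS infS => [r Sr|Soo|Soo].
  - have en1 : 0 < e%:num / (2 ^ n.+1)%:R :> R by [].
    have /(lb_ereal_inf_adherent en1) : ereal_inf S \is a fin_num by rewrite Sr.
    move=> [x [B AnB muBx] xS].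
    by exists B; split => //; rewrite muBx -Sr; exact/ltW.
  - by have := Aoo n; rewrite /leb_outer Soo.
  - by have := leb_outer_ge0 (A n); rewrite /leb_outer Soo.
apply: (@le_trans _ _ (\esum_(i in setT) (vol \o uncurry G) i)).
  have /card_esym/ppcard_eqP[f] := card_nat2.
  apply: ereal_inf_lbound => /=; exists (uncurry G \o f).
    move=> t [i _] /(PG i).1 [j _ Bijt]; exists (f^-1%FUN (i, j)) => //=.
    by rewrite invK ?inE.
  rewrite -(esum_pred_image (vol \o uncurry G) _ xpredT) ?[fun=> _]set_true//.
    by rewrite image_eq.
  by move=> n _; exact: vol_ge0.
have -> : (\esum_(i in setT) (vol \o uncurry G) i =
      \sum_(i <oo) \sum_(j <oo) vol (G i j))%E.
  pose J : nat -> set (nat * nat) := fun i => [set (i, j) | j in setT].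
  rewrite [X in esum X _](_ : _ = \bigcup_k J k); last first.
    by rewrite predeqE => -[a b]; split => // _; exists a => //; exists b.
  rewrite esum_bigcupT /=; last 2 first.
    - apply/trivIsetP => i j _ _ ij.
      rewrite predeqE => -[n m] /=; split => //= -[] [_] _ [<-{n} _].
      by move=> [m' _] [] /esym/eqP; rewrite (negbTE ij).
    - by move=> /= [n m]; exact: vol_ge0.
  rewrite -(image_id [set: nat]) -fun_true esum_pred_image//; last first.
    by move=> n _; exact: esum_ge0.
  apply: eq_eseriesr => /= j _.
  rewrite -(esum_pred_image (vol \o uncurry G) (pair j) predT)//=; last first.
    by move=> ? ? _ _; exact: (@can_inj _ _ _ snd).
  by congr esum; rewrite predeqE => -[a b]; split; move=> [i _ <-]; exists i.
apply: lee_lim.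
- apply: is_cvg_nneseries => n *.
  by apply: nneseries_ge0 => m *; exact: vol_ge0.
- by apply: is_cvg_nneseries => n *; apply: adde_ge0 => //; exact: leb_outer_ge0.
- by near=> n; apply: lee_sum => i _; exact: (PG i).2.
Unshelve. all: by end_near. Qed.

HB.instance Definition _ := isOuterMeasure.Build R V leb_outer
  leb_outer0 leb_outer_ge0 le_leb_outer leb_outer_sigma_subadditive.

Definition leb_outer_measure : {outer_measure set V -> \bar R} := leb_outer.

(* R^(d+1) with the sigma-algebra of Lebesgue measurable sets. *)
Local Notation lebV := (caratheodory_type leb_outer_measure).

Definition leb : {measure set lebV -> \bar R} :=
  (leb_outer_measure : set lebV -> \bar R).

End LebesgueMeasure.
Arguments leb {R d}.

Notation lebV R d := (caratheodory_type (leb_outer_measure R d)).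

Definition norm1 (R : realType) (n : nat) (a : 'cV[R]_n) : R :=
  \sum_j `|a j 0|.

Section Shapes.
Variables (R : realType) (d : nat).
Local Notation V := 'rV[R]_d.+1.
Variable D : set V.

Definition imaging_domain : Prop :=
  open D \/ exists U : set V, open U /\ D = closure U.

(* Topology relative to D; only meaningful for A `<=` D, since the points
   outside D are isolated in [subspace D]. *)
Definition cl_in (A : set V) : set V := closure (A : set (subspace D)).
Definition int_in (A : set V) : set V := interior (A : set (subspace D)).
Definition bd_in (A : set V) : set V := cl_in A `\` int_in A.

Definition null (A : set V) : Prop := leb.-negligible (A : set (lebV R d)).

Definition is_shape (S : set V) : Prop :=
  [/\ S `<=` D, closed (S : set (subspace D)), int_in S !=set0,
      S = cl_in (int_in S) & null (bd_in S)].

Definition cell_family (nO : nat) (Omega : 'I_nO -> set V) : Prop :=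
  (forall i, is_shape (Omega i)) /\
  (forall i i', i != i' -> null (Omega i `&` Omega i')).

Definition comb (n : nat) (S : 'I_n -> set V) (a : 'cV[R]_n) (x : V) : R :=
  \sum_(j < n) a j 0 * \1_(S j) x.

Definition objective (Pin Pex : V -> R) (n : nat) (S : 'I_n -> set V)
    (a : 'cV[R]_n) : R :=
  \int[leb]_(x in (D : set (lebV R d)))
    Num.max ((Pin x - Pex x) * comb S a x) (Num.min (Pin x - Pex x) 0).

Definition is_minimizer (Pin Pex : V -> R) (n : nat) (S : 'I_n -> set V)
    (r : R) (a : 'cV[R]_n) : Prop :=
  norm1 a <= r /\
  forall b, norm1 b <= r -> objective Pin Pex S a <= objective Pin Pex S b.

Definition LOC (Pin Pex : V -> R) (Sigma : set V) : Prop :=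
  (forall x, Sigma x -> Pin x < Pex x) /\
  (forall x, (D `\` Sigma) x -> Pex x < Pin x).

Definition composition (n : nat) (S : 'I_n -> set V) (P M : {set 'I_n}) :
    set V :=
  (\bigcup_(j in [set` P]) S j) `\` (\bigcup_(j in [set` M]) S j).

Definition nonredundant (n : nat) (S : 'I_n -> set V) (P M : {set 'I_n}) :
    Prop :=
  (forall j, j \in P ->
     int_in (composition S (P :\ j) M) <> int_in (composition S P M)) /\
  (forall j, j \in M ->
     int_in (composition S P (M :\ j)) <> int_in (composition S P M)).

Definition dsd_set (n : nat) (S : 'I_n -> set V) (J : {ffun 'I_n -> bool}) :
    set V :=
  \bigcap_j (if J j then S j else cl_in (D `\` S j)).

Definition constructors (n : nat) (S : 'I_n -> set V) :
    {set {ffun 'I_n -> bool}} :=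
  [set J | (J != [ffun=> false]) && `[< int_in (dsd_set S J) !=set0 >]]%SET.

Definition constructor (n : nat) (S : 'I_n -> set V)
    (l : 'I_#|constructors S|) : {ffun 'I_n -> bool} := enum_val l.

Definition shapelet (n : nat) (S : 'I_n -> set V)
    (l : 'I_#|constructors S|) : set V := dsd_set S (constructor l).

Definition bearing (n : nat) (S : 'I_n -> set V) :
    'M[R]_(#|constructors S|, n) :=
  \matrix_(l, j) (constructor l j)%:R.

End Shapes.

Definition col1 (R : realType) (n : nat) : 'cV[R]_n := const_mx 1.
Arguments col1 {R n}.

Definition rows (R : realType) (m n : nat) (A : {set 'I_m})
    (M : 'M[R]_(m, n)) : 'M[R]_(#|A|, n) :=
  rowsub (fun r : 'I_#|A| => enum_val r) M.

(* S lists the shapes of the composition only: the np added ones, then the nm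
   subtracted ones. *)
Section Linkage.
Variables (R : realType) (d : nat).
Local Notation V := 'rV[R]_d.+1.
Variables (D : set V) (np nm : nat) (S : 'I_(np + nm) -> set V).

Definition I_plus : {set 'I_(np + nm)} :=
  [set j : 'I_(np + nm) | (j < np)%N]%SET.
Definition I_minus : {set 'I_(np + nm)} :=
  [set j : 'I_(np + nm) | (np <= j)%N]%SET.

Local Notation B := (bearing D S).
Local Notation L := 'I_#|constructors D S|.

Definition N_plus : {set L} :=
  [set l : L | [exists j in I_plus, constructor l j]]%SET.
Definition N_minus : {set L} :=
  [set l : L | [exists j in I_minus, constructor l j]]%SET.

(* The row of index l of B^(1,1) or B^(2,1) is row l of [lsubmx B], that of
   B^(2,2) is row l of [rsubmx B]. *)
Definition lp_feasible (a : 'cV[R]_nm) : Prop :=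
  forall l, l \in N_minus ->
    (rsubmx B *m a) l 0 <= - (lsubmx B *m col1) l 0.

Definition lp_maximizer (a : 'cV[R]_nm) : Prop :=
  lp_feasible a /\
  forall b, lp_feasible b -> \sum_j b j 0 <= \sum_j a j 0.

Definition Gamma1R : {set L} :=
  [set l in N_plus :\: N_minus | (lsubmx B *m col1) l 0 == 1]%SET.

Definition Gamma0R (a : 'cV[R]_nm) : {set L} :=
  [set l in N_minus | (rsubmx B *m a) l 0 + (lsubmx B *m col1) l 0 == 0]%SET.

Definition DeltaR (a : 'cV[R]_nm) : 'M[R]_(#|Gamma0R a|, nm) :=
  rows (Gamma0R a) (rsubmx B).

Definition basic : Prop :=
  exists a : 'cV[R]_nm,
    [/\ lp_maximizer a, \rank (DeltaR a) = nm, #|Gamma0R a| = nm &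
        exists v : 'cV[R]_(#|Gamma0R a|),
          (DeltaR a)^T *m v = col1 /\ forall l, 0 < v l 0].

Definition alphaR (a : 'cV[R]_nm) : 'cV[R]_(np + nm) := col_mx col1 a.

Definition Gamma01R (a : 'cV[R]_nm) : {set L} := Gamma0R a :|: Gamma1R.

Definition bearing_constants (a : 'cV[R]_nm) (w : 'cV[R]_#|Gamma01R a|) :
    Prop :=
  (rows (Gamma01R a) B)^T *m w = - col_mx col1 (- col1).

End Linkage.

(* S is the whole dictionary: the np + nm shapes of the composition, then the
   k others, so that n_s = np + nm + k. *)
Section Cells.
Variables (R : realType) (d : nat).
Local Notation V := 'rV[R]_d.+1.
Variables (D : set V) (np nm k : nat) (S : 'I_(np + nm + k) -> set V).
Variables (nO : nat) (Omega : 'I_nO -> set V).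

Definition first_shapes (j : 'I_(np + nm)) : set V := S (lshift k j).
Definition last_shapes (j : 'I_k) : set V := S (rshift (np + nm) j).
Local Notation S1 := first_shapes.
Local Notation S2 := last_shapes.

Definition dictionary : Prop :=
  [/\ forall j, is_shape D (S j),
      forall j, exists A : {set 'I_nO}, S j = \bigcup_(i in [set` A]) Omega i &
      forall i, exists j, Omega i `<=` S j].

Definition cells_of (l : 'I_#|constructors D S1|) : {set 'I_nO} :=
  [set i | `[< Omega i `<=` shapelet l >]]%SET.

Definition outer_cells : {set 'I_nO} :=
  [set i |
    `[< null (Omega i `\` ((\bigcup_j S j) `\` (\bigcup_j S1 j))) >]]%SET.

Definition Gamma0 (a : 'cV[R]_nm) : {set 'I_nO} :=
  outer_cells :|: \bigcup_(l in Gamma0R D S1 a) cells_of l.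

Definition Gamma1 : {set 'I_nO} := \bigcup_(l in Gamma1R D S1) cells_of l.

Definition incidence (m : nat) (S' : 'I_m -> set V) : 'M[R]_(m, nO) :=
  \matrix_(j, i) `[< Omega i `<=` S' j >]%:R.

Definition cell_columns (A : {set 'I_nO}) (m : nat) (M : 'M[R]_(m, nO)) :
    'M[R]_(m, #|A|) :=
  colsub (fun c : 'I_#|A| => enum_val c) M.

Definition bearing_cells1 (a : 'cV[R]_nm) :
    'M[R]_(np + nm, #|Gamma0 a :|: Gamma1|) :=
  cell_columns (Gamma0 a :|: Gamma1) (incidence S1).

Definition bearing_cells2 (a : 'cV[R]_nm) :
    'M[R]_(k, #|Gamma0 a :|: Gamma1|) :=
  cell_columns (Gamma0 a :|: Gamma1) (incidence S2).

Definition cell_ratio (l : 'I_#|constructors D S1|) (j : 'I_k) : R :=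
  (\sum_(i in cells_of l) incidence S2 j i) / #|cells_of l|%:R.

End Cells.

(* Main.v *)
Require Import Defs.
From mathcomp Require Import all_boot all_order all_algebra.
From mathcomp Require Import all_classical all_reals all_analysis.
From mathcomp Require Import measurable_realfun ring lra.

Set Implicit Arguments.
Unset Strict Implicit.
Unset Printing Implicit Defensive.

Import Order.TTheory GRing.Theory Num.Theory.
Import numFieldNormedType.Exports.

Local Open Scope classical_set_scope.
Local Open Scope ring_scope.

(** Write u = Pin - Pex and L_a for the combination of the shapes with
    coefficients a.  By the lucid object condition u < 0 on Sigma and u > 0 off
    Sigma, so the integrand max (u L_a, min (u, 0)) of the objective is bounded
    below by min (u, 0), which does not depend on a.  Hence every a with
    objective equal to the integral of min (u, 0) is a minimizer, and this
    happens exactly when u L_a <= min (u, 0) almost everywhere, that is L_a >= 1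
    on Sigma and L_a <= 0 off Sigma, up to null sets ([clipped_eqP]).

    The candidate [col_mx (alphaR np adag) 0] has this property, because the
    constraints of the linear program say that its combination is nonpositive
    on the shapelets meeting a subtracted shape ([comb_alphaR_lucid]).  So the
    remaining question is uniqueness: let a = candidate + (h, h') be another
    minimizer.  Cell by cell, and after averaging over the cells of a shapelet l,
      (B h)_l + sum_j gamma_lj h'_j
    is nonpositive for l in Gamma_0 and nonnegative for l in Gamma_1.  The
    bearing constants w are positive on Gamma_0, where they solve the dual of
    the linear program, and negative on Gamma_1.  Multiplying by w_l and adding
    up, the definition of w turns the first term into - cbar . h, where cbar has
    the entries 1 and - 1, and the bound on the second one gives
      cbar . h >= - sum_j c_j |h'_j|  with every 0 <= c_j < 1.
    On the other hand cbar is the sign vector of alphaR, so the constraint on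
    the 1-norm gives cbar . h + sum_j |h'_j| <= 0.  Together these force h' = 0,
    and then equality in all the inequalities: B h vanishes on Gamma_0 and
    Gamma_1, a square invertible system, so h = 0 ([certificate_unique]).

    Geometry enters through generic points, those on no boundary of a shape of
    the composition.  They are dense and of full measure, since nonempty
    relatively open sets are not null, and the list of shapes that contain a
    generic point does not change near it.  This converts the topological
    conditions (nonempty interiors of shapelets, non-redundancy, closure of the
    composition) into the existence of points with prescribed membership. *)

(** * Open sets are Lebesgue measurable *)

Section OpenMeasurable.
Variables (R : realType) (d : nat).
Local Notation V := 'rV[R]_d.+1.
Implicit Types (a b x : V) (i : 'I_d.+1).

Definition halfspace i (c : R) : set V := [set x | x 0 i <= c].

Definition set_coord x i (c : R) : V := \row_j (if j == i then c else x 0 j).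

Lemma box_halfspace a b i c :
  box a b `&` halfspace i c `<=` box a (set_coord b i (Num.min (b 0 i) c)).
Proof.
move=> x [abx xc] j; rewrite mxE; case: eqP => [->|_]; last exact: abx.
by have /andP[-> xb] := abx i; rewrite le_min xb.
Qed.

Lemma box_halfspaceC a b i c :
  box a b `&` ~` halfspace i c `<=` box (set_coord a i (Num.max (a 0 i) c)) b.
Proof.
move=> x [abx /negP]; rewrite -ltNge => cx j.
rewrite mxE; case: eqP => [->|_]; last exact: abx.
by have /andP[ax ->] := abx i; rewrite gt_max ax cx.
Qed.

Lemma box_vol_split a b i c :
  box_vol a (set_coord b i (Num.min (b 0 i) c)) +
  box_vol (set_coord a i (Num.max (a 0 i) c)) b = box_vol a b.
Proof.
rewrite /box_vol (bigD1 i)//= [X in _ + X](bigD1 i)//= [RHS](bigD1 i)//=.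
rewrite !mxE eqxx.
under eq_bigr => j ji do rewrite mxE (negbTE ji).
under [X in _ + _ * X = _]eq_bigr => j ji do rewrite mxE (negbTE ji).
rewrite -mulrDl; congr (_ * _).
move: (a 0 i) (b 0 i) => u v.
by case: (lerP v c) => vc; case: (lerP u c) => uc;
  do 3?[case: (lerP 0 _) => ?]; lra.
Qed.

(** Cutting every box of a cover along the hyperplane covers both pieces
    without changing the total volume. *)
Lemma measurable_halfspace i c : measurable (halfspace i c : set (lebV R d)).
Proof.
apply: le_caratheodory_measurable => X.
apply: le_ereal_inf_tmp => _ [F XF <-].
pose lo k := ((F k).1, set_coord (F k).2 i (Num.min ((F k).2 0 i) c)).
pose hi k := (set_coord (F k).1 i (Num.max ((F k).1 0 i) c), (F k).2).
have cover_lo : X `&` halfspace i c `<=` \bigcup_k box (lo k).1 (lo k).2.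
  move=> x [/XF[k _ Fx] xc]; exists k => //; exact: box_halfspace.
have cover_hi : X `&` ~` halfspace i c `<=` \bigcup_k box (hi k).1 (hi k).2.
  move=> x [/XF[k _ Fx] xc]; exists k => //; exact: box_halfspaceC.
apply: (@le_trans _ _ (\sum_(k <oo) (box_vol (lo k).1 (lo k).2)%:E +
                       \sum_(k <oo) (box_vol (hi k).1 (hi k).2)%:E)%E).
  by apply: leeD; apply: ereal_inf_lbound; [exists lo|exists hi].
rewrite -nneseriesD; [|by move=> *; exact: box_volE_ge0..].
rewrite le_eqVlt; apply/orP; left; apply/eqP/eq_eseriesr => k _.
by rewrite -EFinD box_vol_split.
Qed.

Lemma measurable_box a b : measurable (box a b : set (lebV R d)).
Proof.
rewrite (_ : box a b = \bigcap_(i in [set: 'I_d.+1])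
    (halfspace i (b 0 i) `&` ~` halfspace i (a 0 i))); last first.
  apply/seteqP; split => x /= xab i => [_|]; last first.
    by have [xb /negP] := xab i I; rewrite -ltNge => -> /=.
  by have /andP[ax xb] := xab i; split => //=; apply/negP; rewrite -ltNge.
apply: fin_bigcap_measurable; first exact: finite_finset.
move=> i _; apply: measurableI; first exact: measurable_halfspace.
exact/measurableC/measurable_halfspace.
Qed.

(** An open set is the union of the boxes with rational corners that it
    contains. *)
Lemma measurable_open (U : set V) :
  open U -> measurable (U : set (lebV R d)).
Proof.
move=> oU.
pose rv (q : 'rV[rat]_d.+1) : V := map_mx ratr q.
pose B (p : 'rV[rat]_d.+1 * 'rV[rat]_d.+1) := box (rv p.1) (rv p.2).
rewrite (_ : U = \bigcup_(p in [set p | B p `<=` U]) B p); last first.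
  apply/seteqP; split => [x Ux|x [p pU] /pU//].
  have /nbhs_ballP[e /= e0 eU] := open_nbhs_nbhs (conj oU Ux).
  have lo i : {q | ratr q \in `]x 0 i - e / 2, x 0 i[}.
    by apply/cid/rat_in_itvoo; rewrite ltrBlDr ltrDl divr_gt0.
  have hi i : {q | ratr q \in `]x 0 i, x 0 i + e / 2[}.
    by apply/cid/rat_in_itvoo; rewrite ltrDl divr_gt0.
  exists (\row_i sval (lo i), \row_i sval (hi i)) => [y /= yB|i].
    apply: eU; split=> // k i; rewrite !ord1 /ball /=.
    have := yB i; rewrite !mxE.
    case: (lo i) (hi i) => /= p + [q /=]; rewrite !in_itv /=.
    move=> /andP[p1 p2] /andP[q1 q2] /andP[py yq].
    by rewrite ltr_norml; apply/andP; split; lra.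
  rewrite !mxE; case: (lo i) (hi i) => /= p + [q /=]; rewrite !in_itv /=.
  by move=> /andP[_ ->] /andP[/ltW ->].
rewrite bigcup_mkcond; apply: countable_bigcupT_measurable => [|p].
  exact: countableP.
by case: ifP => _; [exact: measurable_box|exact: measurable0].
Qed.

End OpenMeasurable.

(** * Nonempty open sets are not null *)

Section Positivity.
Variable R : realType.

(** Summing the indicators of a cover gives a function that is at least one on
    the cube; integrating it in one coordinate at a time turns the indicators
    into side lengths.  The weights c collect the sides of the coordinates that
    have been integrated out, which is what makes the induction go through. *)
Lemma cube_cover_weight n (s : R) (a : nat -> R) (lo hi : nat -> nat -> R)
    (c : nat -> R) :
  0 < s -> (forall k, 0 <= c k) ->
  (forall x : nat -> R, (forall i, a i <= x i <= a i + s) ->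
    (1 <= \sum_(k <oo)
       (c k * \prod_(i < n) \1_(`]lo k i, hi k i]%classic) (x i))%:E)%E) ->
  (1 <= \sum_(k <oo)
     (c k * \prod_(i < n) (Num.max 0 (hi k i - lo k i) / s))%:E)%E.
Proof.
move=> s0; elim: n c => [|n IHn] c c0 cover.
  have := cover a; under eq_eseriesr do rewrite big_ord0.
  under [in X in _ -> X]eq_eseriesr do rewrite big_ord0.
  by apply=> i; rewrite lexx lerDl ltW.
pose len k := Num.max 0 (hi k n - lo k n).
have len0 k : 0 <= len k by rewrite le_max lexx.
have := IHn (fun k => c k * (len k / s)).
under [in X in _ -> X]eq_eseriesr do rewrite big_ord_recr /= [_ * (_ / s)]mulrC mulrA.
apply=> [k|x xcube]; first by rewrite mulr_ge0 // divr_ge0 // ltW.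
pose I k : set (measurableTypeR R) := `]lo k n, hi k n]%classic.
pose J k := c k * \prod_(i < n) \1_(`]lo k i, hi k i]%classic) (x i).
have J0 k : 0 <= J k by rewrite mulr_ge0 // prodr_ge0.
pose E : set (measurableTypeR R) := `[a n, a n + s]%classic.
have mE : measurable E by exact: measurable_itv.
have mI k : measurable (I k) by exact: measurable_itv.
have slice t : E t -> (1 <= \sum_(k <oo) ((J k)%:E * (\1_(I k) t)%:E))%E.
  rewrite /E /= in_itv /= => Et.
  have := cover (fun i => if i == n then t else x i).
  under eq_eseriesr => k _.
    rewrite big_ord_recr /= eqxx mulrA.
    under eq_bigr => i _ do rewrite ltn_eqF //.
    rewrite EFinM.
  over.
  by apply=> i; case: eqP => [->|].
have muE : lebesgue_measure E = s%:E.
  by rewrite /E lebesgue_measure_itv /= lte_fin ltrDl s0 -EFinB addrAC subrr add0r.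
pose f k : R -> \bar R := fun t : R => ((J k)%:E * (\1_(I k) t)%:E)%E.
pose g k : R -> \bar R := EFin \o \1_(I k).
have mg k : measurable_fun E (g k).
  by apply/measurable_EFinP; exact: measurable_indic.
have mf k : measurable_fun E (f k).
  by apply: emeasurable_funM; [exact: measurable_cst|exact: mg].
have f0 k t : (0 <= f k t)%E by rewrite mule_ge0 ?lee_fin.
have : (s%:E <= \sum_(k <oo) ((J k)%:E * (len k)%:E))%E.
  rewrite -muE -[leLHS]mul1e -(integral_cst lebesgue_measure mE 1%E).
  apply: (@le_trans _ _
    (\int[lebesgue_measure]_(t in E) \sum_(k <oo) f k t))%E.
    apply: ge0_le_integral => //.
    by apply: ge0_emeasurable_sum => // k _; exact: mf.
  rewrite integral_nneseries //; apply: lee_nneseries => [k _ _|k _].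
    by apply: integral_ge0 => t _; exact: f0.
  rewrite ge0_integralZl_EFin //; last exact: mg.
  rewrite integral_indic //; apply: lee_wpmul2l; first by rewrite lee_fin.
  apply: (@le_trans _ _ (lebesgue_measure (I k))).
    by apply: le_measure; rewrite ?inE //; exact: measurableI.
  rewrite /I lebesgue_measure_itv /= lte_fin /len.
  case: ltP => h; first by rewrite -EFinB lee_fin le_max lexx orbT.
  by rewrite lee_fin le_max lexx.
move=> sJ.
under eq_eseriesr => k _.
  rewrite (_ : _ * _ = s^-1 * (J k * len k)); last by rewrite /J; ring.
  rewrite EFinM.
over.
rewrite nneseriesZl; last by move=> k _; rewrite lee_fin mulr_ge0.
under eq_eseriesr do rewrite EFinM.
have -> : 1%E = (s^-1%:E * s%:E)%E :> \bar R by rewrite -EFinM mulVf ?gt_eqF.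
by apply: lee_wpmul2l => //; rewrite lee_fin invr_ge0 ltW.
Qed.

Variable d : nat.
Local Notation V := 'rV[R]_d.+1.

(** Exhibiting covers only bounds the outer measure from above; this is the
    matching bound from below. *)
Lemma cube_leb_outer (a : V) (s : R) : 0 < s ->
  ((s ^+ d.+1)%:E <=
     leb_outer [set x : V | forall i, a 0 i <= x 0 i <= a 0 i + s]%R)%E.
Proof.
move=> s0; apply: le_ereal_inf_tmp => _ [F cover <-].
pose lo k i := (F k).1 0 (inord i).
pose hi k i := (F k).2 0 (inord i).
have -> : (\sum_(k <oo) (box_vol (F k).1 (F k).2)%:E =
    (s ^+ d.+1)%:E * \sum_(k <oo)
      (1 * \prod_(i < d.+1) (Num.max 0 (hi k i - lo k i) / s))%:E)%E.
  rewrite -nneseriesZl => [|k _]; last first.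
    by rewrite lee_fin mul1r prodr_ge0 // => i _; rewrite divr_ge0 ?le_max ?lexx // ltW.
  apply: eq_eseriesr => k _; rewrite -EFinM; congr EFin.
  under eq_bigr do rewrite /lo /hi inord_val.
  rewrite mul1r big_split /= prodr_const card_ord exprVn mulrCA divff ?mulr1 //.
  by rewrite expf_neq0 ?gt_eqF.
rewrite -[leLHS]mule1; apply: lee_wpmul2l; first by rewrite lee_fin exprn_ge0 // ltW.
apply: (@cube_cover_weight d.+1 s (fun i => a 0 (inord i)) lo hi (cst 1)) => // x xcube.
have [i|k _ Fx] := cover (\row_i x i); first by rewrite mxE; have := xcube i; rewrite inord_val.
have t0 j : (0 <= (1 * \prod_(i < d.+1)
    \1_(`]lo j i, hi j i]%classic : set R) (x i))%:E)%E.
  by rewrite lee_fin mul1r prodr_ge0.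
apply: (@le_trans _ _ (1 * \prod_(i < d.+1)
    \1_(`]lo k i, hi k i]%classic : set R) (x i))%:E).
  rewrite mul1r big1 // => i _; have := Fx i; rewrite mxE => h.
  by rewrite indicE mem_set //= in_itv /lo /hi /= inord_val.
rewrite (@nneseriesD1 _ _ k) => [|j _|//]; last exact: t0.
by rewrite leeDl // nneseries_ge0 // => j _ _; exact: t0.
Qed.

Lemma open_not_null (U : set V) : open U -> U !=set0 -> ~ null U.
Proof.
move=> oU [x Ux] [B [mB B0 UB]].
have /nbhs_ballP[e /= e0 eU] := open_nbhs_nbhs (conj oU Ux).
have e20 : 0 < e / 2 by rewrite divr_gt0.
have := cube_leb_outer x e20.
rewrite leNgt => /negP; apply; apply: (@le_lt_trans _ _ (leb_outer B)).
  apply: le_leb_outer => y yx; apply/UB/eU; split=> // k i; rewrite !ord1 /ball /=.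
  have /andP[h1 h2] := yx i.
  by rewrite ltr_norml; apply/andP; split; lra.
by move: B0; rewrite /leb /= => ->; rewrite lte_fin exprn_gt0.
Qed.

End Positivity.
(** * Null sets, the relative topology and generic points *)

Lemma null_bigcup (R : realType) (d : nat) (I : countType)
    (F : I -> set 'rV[R]_d.+1) :
  (forall i, null (F i)) -> null (\bigcup_i F i).
Proof.
move=> F0; pose G k := if unpickle k is Some i then F i else set0.
have : null (\bigcup_k G k).
  apply: negligible_bigcup => k; rewrite /G; case: unpickle => [i|].
    exact: F0.
  exact: negligible_set0.
by apply: negligibleS => x [i _ Fx]; exists (pickle i) => //; rewrite /G pickleK.
Qed.

Section RelativeTopology.
Variables (R : realType) (d : nat).
Local Notation V := 'rV[R]_d.+1.
Variable D : set V.
Implicit Types (A N : set V) (x : V).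

Lemma int_inP A x : D x -> int_in D A x <-> \forall y \near x, D y -> A y.
Proof.
move=> Dx; change (nbhs_subspace (x : subspace D) A <-> within D (nbhs x) A).
by rewrite nbhs_subspace_in.
Qed.

Lemma int_in_sub A : int_in D A `<=` A.
Proof. exact: (@interior_subset (subspace D)). Qed.

Lemma int_inS A A' : A `<=` A' -> int_in D A `<=` int_in D A'.
Proof. exact: (@interiorS (subspace D)). Qed.

Lemma sub_cl_in A : A `<=` cl_in D A.
Proof. exact: (@subset_closure (subspace D)). Qed.

Lemma cl_inP A x (P : V -> Prop) : A `<=` D -> cl_in D A x ->
  (\forall y \near x, D y -> P y) -> exists2 y, A y & P y.
Proof.
move=> AD; rewrite /cl_in closure_subspaceW // => -[clA Dx] nP.
by have [y [Ay Py]] := clA _ nP; exists y => //; apply/Py/AD.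
Qed.

Lemma cl_in_near A x : A `<=` D -> D x ->
  (forall W, nbhs x W -> A `&` W !=set0) -> cl_in D A x.
Proof. by move=> AD Dx h; rewrite /cl_in closure_subspaceW. Qed.

Lemma shape_sub A : is_shape D A -> A `<=` D. Proof. by case. Qed.

Lemma shape_nearN A x : is_shape D A -> D x -> ~ A x ->
  \forall y \near x, D y -> ~ A y.
Proof.
case=> _ clA _ _ _ Dx nAx; apply/(int_inP (~` A) Dx).
exact: (@open_nbhs_nbhs (subspace D) _ _ (conj (closed_openC clA) nAx)).
Qed.

Hypothesis domD : imaging_domain D.

Lemma measurable_domain : measurable (D : set (lebV R d)).
Proof.
case: domD => [/measurable_open//|[U [_ ->]]].
rewrite -[closure U]setCK; apply/measurableC/measurable_open.
exact/closed_openC/closed_closure.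
Qed.

Lemma measurable_shape A : is_shape D A -> measurable (A : set (lebV R d)).
Proof.
case=> AD /closed_subspaceP[C clC CD] _ _ _.
rewrite -(setIidl AD) -CD -[C]setCK; apply: measurableI measurable_domain.
by apply/measurableC/measurable_open/closed_openC.
Qed.

(** Null sets have dense complement in the domain, because near each of its
    points the domain contains a nonempty open set of the whole space. *)
Lemma conull_dense N x (P : V -> Prop) : null N -> D x ->
  (\forall y \near x, D y -> P y) -> exists y, [/\ D y, P y & ~ N y].
Proof.
move=> N0 Dx nP; apply: contrapT => none.
pose W := interior [set y | D y -> P y].
have oW : open W by exact: open_interior.
have [G [oG GW GD]] : exists G, [/\ open G, G `&` W !=set0 & G `<=` D].
  case: domD => [oD|[U [oU DU]]].
    by exists D; split=> //; exists x; split=> //; exact: nP.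
  exists U; split=> //; last by rewrite DU; exact: subset_closure.
  by move: Dx; rewrite DU => /(_ _ (nbhs_interior nP)).
apply: (open_not_null (openI oG oW) GW); apply: negligibleS N0.
move=> y [/GD Dy /interior_subset Py]; apply: contrapT => Ny.
by apply: none; exists y; split => //; exact: Py.
Qed.

Lemma shape_not_null A : is_shape D A -> ~ null A.
Proof.
move=> [AD _ [x Ax] _ _] A0; have Dx := AD _ (int_in_sub Ax).
by have [y [_]] := conull_dense A0 Dx ((int_inP A Dx).1 Ax).
Qed.

Section Family.
Variables (n : nat) (S : 'I_n -> set V).
Hypothesis shS : forall j, is_shape D (S j).

(** The points at which every shape looks locally like the whole domain or like
    the empty set. *)
Definition generic x := D x /\ forall j, ~ bd_in D (S j) x.

(** For a generic point this is the constructor of the shapelet that contains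
    it, or the zero vector outside all the shapes. *)
Definition signature x : {ffun 'I_n -> bool} := [ffun j => `[< S j x >]].

Lemma signatureP x j : reflect (S j x) (signature x j).
Proof. by rewrite ffunE; exact: asboolP. Qed.

Lemma null_boundaries : null (\bigcup_j bd_in D (S j)).
Proof. by apply: null_bigcup => j; have [] := shS j. Qed.

(** Off its boundary a shape is a neighbourhood of its points, and its complement
    of the others because shapes are closed. *)
Lemma generic_near x : generic x ->
  \forall y \near x, D y -> signature y = signature x.
Proof.
move=> [Dx bdx].
have : \forall y \near x, forall j, D y -> signature y j = signature x j.
  apply: (@filter_forall _ _ (fun j y => D y -> signature y j = signature x j) _ (nbhs_filter x)) => j.
  rewrite /= [signature x j]ffunE; case: asboolP => Sx.
    have : int_in D (S j) x.
      by apply: contrapT => ni; apply: (bdx j); split => //; exact: sub_cl_in.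
    by move/(int_inP _ Dx); apply: filterS => y h /h; rewrite ffunE => /asboolT.
  have := shape_nearN (shS j) Dx Sx.
  by apply: filterS => y h /h; rewrite ffunE => /asboolF.
by apply: filterS => y h Dy; apply/ffunP => j; exact: h.
Qed.

Lemma generic_dense N x (P : V -> Prop) : null N -> D x ->
  (\forall y \near x, D y -> P y) -> exists y, [/\ generic y, P y & ~ N y].
Proof.
move=> N0 Dx nP.
have [y [Dy Py /not_orP[Ny bdy]]] := conull_dense (negligibleU N0 null_boundaries) Dx nP.
by exists y; split => //; split => // j bj; apply: bdy; exists j.
Qed.

Lemma dsd_set_sub J : J != [ffun=> false] -> dsd_set D S J `<=` D.
Proof.
move=> J0 x Jx; have [j Jj] : exists j, J j.
  apply: contrapT => nJ; case/negP: J0; apply/eqP/ffunP => j; rewrite ffunE.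
  by apply/negbTE/negP => Jj; apply: nJ; exists j.
by have := Jx j I; rewrite Jj; exact/shape_sub.
Qed.

Lemma generic_int_dsd x : generic x -> int_in D (dsd_set D S (signature x)) x.
Proof.
move=> gx; have [Dx _] := gx; apply/(int_inP _ Dx).
apply: filterS (generic_near gx) => y h Dy j _.
have := h Dy; move/ffunP/(_ j) => <-; case: ifPn => [/signatureP//|/signatureP nS].
exact: sub_cl_in.
Qed.

Lemma generic_dsd x J : generic x -> dsd_set D S J x -> J = signature x.
Proof.
move=> gx Jx; apply/ffunP => j; have := Jx j I.
case: ifP => [_ /signatureP->//|_ clx].
have [y [Dy nSy] /ffunP/(_ j)] := cl_inP (@subDsetl _ _ _) clx (generic_near gx).
by rewrite [LHS]ffunE => <-; apply/esym/asboolF.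
Qed.

Lemma generic_constructor x : generic x -> signature x != [ffun=> false] ->
  exists l : 'I_#|constructors D S|, constructor l = signature x.
Proof.
move=> gx x0; have xJ : signature x \in constructors D S.
  by rewrite inE x0; apply/asboolP; exists x; exact: generic_int_dsd.
by exists (enum_rank_in xJ (signature x)); rewrite /constructor enum_rankK_in.
Qed.

Lemma shapelet_generic (l : 'I_#|constructors D S|) N : null N ->
  exists x, [/\ generic x, constructor l = signature x & ~ N x].
Proof.
move=> N0; have := enum_valP l; rewrite inE => /andP[J0 /asboolP[x ix]].
have Dx : D x by apply: (dsd_set_sub J0); exact: int_in_sub ix.
have [y [gy Jy Ny]] := generic_dense N0 Dx ((int_inP _ Dx).1 ix).
by exists y; split => //; exact: generic_dsd.
Qed.

Variables (P M : {set 'I_n}).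

Lemma compositionP x : composition S P M x <->
  (exists2 j, j \in P & S j x) /\ (forall j, j \in M -> ~ S j x).
Proof.
split => [[[j Pj Sj] nM]|[[j Pj Sj] nM]]; split; do ?by exists j.
- by move=> i Mi Si; apply: nM; exists i.
- by move=> [i Mi Si]; exact: (nM i).
Qed.

Lemma composition_sub : composition S P M `<=` D.
Proof. by move=> x [[j _ /(shape_sub (shS j))]]. Qed.

(** Membership in the composition is decided by the signature, which is locally
    constant at generic points; so closing it adds no generic point. *)
Lemma generic_composition x : generic x ->
  cl_in D (composition S P M) x <-> composition S P M x.
Proof.
move=> gx; split => [clx|]; last exact: sub_cl_in.
have [y /compositionP[[j Pj Sy] nM] /ffunP yx] :=
  cl_inP composition_sub clx (generic_near gx).
apply/compositionP; split => [|i Mi /signatureP].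
  by exists j => //; apply/signatureP; rewrite -yx; exact/signatureP.
by rewrite -yx => /signatureP; exact: nM.
Qed.

End Family.

(** Otherwise removing the shape would change the composition only inside a
    null set, hence not its interior, as the shapes are closed. *)
Lemma nonredundant_plus n (S : 'I_n -> set V) (P M : {set 'I_n}) j :
  (forall j, is_shape D (S j)) -> nonredundant D S P M -> j \in P ->
  exists x, [/\ generic S x, S j x &
    forall i, i \in P :|: M -> i != j -> ~ S i x].
Proof.
move=> shS [nonred _] Pj; apply: contrapT => none; apply: (nonred j Pj).
apply/seteqP; split; last move=> x ix.
  apply: int_inS => x /compositionP[[i]]; rewrite inE => /andP[_ Pi] Si nM.
  by apply/compositionP; split=> //; exists i.
have Dx : D x by apply: (composition_sub shS); exact: int_in_sub ix.
apply/(int_inP _ Dx); have := (int_inP _ Dx).1 ix => /nbhs_interior.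
apply: filterS => y nRy Dy.
have /compositionP[[i0 Pi0 Si0] nM] := nbhs_singleton nRy Dy.
apply/compositionP; split => //; apply: contrapT => nP.
have nearP : \forall z \near y, forall i, D z -> i \in P :\ j -> ~ S i z.
  apply: (@filter_forall _ _ (fun i z => D z -> i \in P :\ j -> ~ S i z) _
    (nbhs_filter y)) => i.
  case: (boolP (i \in P :\ j)) => Pi; last exact: nearW.
  have Siy : ~ S i y by move=> Si; apply: nP; exists i.
  by apply: filterS (shape_nearN (shS i) Dy Siy) => z h /h.
have [|z [gz [Rz nPz] _]] := generic_dense (S := S) (N := set0)
  (P := fun z => composition S P M z /\ forall i, i \in P :\ j -> ~ S i z)
  shS (negligible_set0 _) Dy.
  by apply: filterS (filterI nRy nearP) => z [h1 h2] Dz; split=> [|i]; [exact: h1|exact: h2].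
apply: none; exists z; have /compositionP[[i Pi Si] nMz] := Rz.
have eij : i = j.
  by apply: contrapT => /eqP ij; apply: (nPz i) => //; rewrite !inE ij.
split=> // [|i']; first by rewrite -eij.
rewrite inE => /orP[Pi' i'j|Mi' _]; last exact: nMz.
by apply: nPz; rewrite !inE i'j.
Qed.

(** Otherwise the composition without the subtracted shape would meet that shape
    in no generic point, so its interior would avoid the shape. *)
Lemma nonredundant_minus n (S : 'I_n -> set V) (P M : {set 'I_n}) j :
  (forall j, is_shape D (S j)) -> nonredundant D S P M -> j \in M ->
  exists x, [/\ generic S x, S j x &
    forall i, i \in M -> i != j -> ~ S i x].
Proof.
move=> shS [_ nonred] Mj; apply: contrapT => none; apply: (nonred j Mj).
apply/seteqP; split; last first.
  apply: int_inS => x /compositionP[exP nM].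
  by apply/compositionP; split=> // i; rewrite inE => /andP[_]; exact: nM.
move=> x ix.
have Dx : D x by apply: (composition_sub shS); exact: int_in_sub ix.
apply/(int_inP _ Dx); have := (int_inP _ Dx).1 ix => /nbhs_interior.
apply: filterS => y nRy Dy.
have /compositionP[exP nM] := nbhs_singleton nRy Dy.
apply/compositionP; split => // i Mi; have [->|ij] := eqVneq i j; last first.
  by apply: nM; rewrite !inE ij.
(* The shape is the closure of its interior: a point of it near y yields a
   whole open set of such points. *)
have [SD _ _ Scl _] := shS j; rewrite {1}Scl => cly.
have ID : int_in D (S j) `<=` D by move=> z /int_in_sub/SD.
have [z iz nRz] := cl_inP ID cly (filterS (fun z h _ => h) (nbhs_interior nRy)).
have Dz := ID _ iz.
have [|u [gu [Ru Su] _]] := generic_dense (S := S) (N := set0)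
  (P := fun z => composition S P (M :\ j) z /\ S j z)
  shS (negligible_set0 _) Dz.
  apply: filterS (filterI nRz ((int_inP _ Dz).1 iz)) => u [h1 h2] Du.
  by split; [exact: h1|exact: h2].
apply: none; exists u; have /compositionP[_ nMu] := Ru.
by split=> // i' Mi' i'j; apply: nMu; rewrite !inE i'j.
Qed.

End RelativeTopology.

(** * The lower bound of the objective *)

(** The integrand of the objective, for u the difference of the two densities and
    L the combination of the shapes. *)
Definition clipped (T : Type) (R : realType) (u L : T -> R) (x : T) : R :=
  Num.max (u x * L x) (Num.min (u x) 0).

Definition negpart (T : Type) (R : realType) (u : T -> R) (x : T) : R :=
  Num.min (u x) 0.

Section ClippedIntegral.
Context disp (T : measurableType disp) (R : realType).
Variables (mu : {measure set T -> \bar R}) (D : set T).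
Hypothesis mD : measurable D.
Variable u : T -> R.
Hypothesis iu : mu.-integrable D (EFin \o u).

Lemma integrable_negpart : mu.-integrable D (EFin \o negpart u).
Proof.
apply: (le_integrable mD _ _ iu).
  apply/measurable_EFinP/measurable_minr; last exact: measurable_cst.
  exact/measurable_EFinP/(measurable_int _ iu).
move=> x Dx /=; rewrite lee_fin /negpart.
by case: (ltP (u x) 0) => _; rewrite ?normr0.
Qed.

Variables (L : T -> R) (c : R).
Hypotheses (mL : measurable_fun D L) (Lc : forall x, D x -> `|L x| <= c).

Lemma integrable_clipped : mu.-integrable D (EFin \o clipped u L).
Proof.
apply: (@le_integrable _ _ _ mu _ mD _ (fun x => (c + 1)%:E * (u x)%:E)%E); last first.
- exact: integrableZl.
- move=> x Dx; rewrite -EFinM /= lee_fin normrM.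
  have c0 : 0 <= c by exact: le_trans (Lc Dx).
  rewrite [`|c + 1|]ger0_norm ?addr_ge0 // mulrDl mul1r.
  have h : `|u x * L x| <= c * `|u x|.
    by rewrite normrM mulrC; apply: ler_wpM2r => //; exact: Lc.
  have cu : 0 <= c * `|u x| by rewrite mulr_ge0.
  rewrite /clipped /Num.max; case: ifP => _.
    by case: (ltP (u x) 0) => _; rewrite ?normr0; have := normr_ge0 (u x); lra.
  by have := normr_ge0 (u x); lra.
- have mu_ : measurable_fun D u by exact/measurable_EFinP/(measurable_int _ iu).
  apply/measurable_EFinP/measurable_maxr; first exact: measurable_funM.
  by apply: measurable_minr => //; exact: measurable_cst.
Qed.

Lemma le_clipped x : negpart u x <= clipped u L x.
Proof. by rewrite /clipped le_max lexx orbT. Qed.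

Lemma clipped_ge : \int[mu]_(x in D) negpart u x <= \int[mu]_(x in D) clipped u L x.
Proof.
apply: le_Rintegral => //; [exact: integrable_negpart|exact: integrable_clipped|].
by move=> x _; exact: le_clipped.
Qed.

(** The difference of the integrands is nonnegative, so its integral vanishes
    only if it vanishes almost everywhere. *)
Lemma clipped_eqP : \int[mu]_(x in D) clipped u L x = \int[mu]_(x in D) negpart u x <->
  {ae mu, forall x, D x -> u x * L x <= negpart u x}.
Proof.
have iN := integrable_negpart; have iC := integrable_clipped.
pose g x := clipped u L x - negpart u x.
have g0 x : 0 <= g x by rewrite subr_ge0 le_clipped.
have ig : mu.-integrable D (EFin \o g).
  by apply: eq_integrable (integrableB mD iC iN).
have gE : \int[mu]_(x in D) g x =
    \int[mu]_(x in D) clipped u L x - \int[mu]_(x in D) negpart u x.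
  exact: RintegralB.
have gP x : g x = 0 <-> u x * L x <= negpart u x.
  rewrite /g /clipped -/(negpart u x); case: (lerP (u x * L x) (negpart u x)) => h.
    by rewrite subrr.
  by split=> ?; lra.
have gabs : (\int[mu]_(x in D) `|(EFin \o g) x| = \int[mu]_(x in D) (g x)%:E)%E.
  by apply: eq_integral => x _ /=; rewrite ger0_norm.
have [ae0 ae1] := ae_eq_integral_abs mu mD (measurable_int _ ig).
rewrite gabs in ae0 ae1.
have -> : (\int[mu]_(x in D) clipped u L x = \int[mu]_(x in D) negpart u x) <->
    (\int[mu]_(x in D) (g x)%:E = 0)%E.
  have fg := integrable_fin_num mD ig.
  split=> [e|e]; last by apply/eqP; rewrite -subr_eq0 -gE /Rintegral e.
  rewrite -[LHS]fineK //; congr EFin; rewrite -/(Rintegral _ _ _).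
  by apply/eqP; rewrite gE e subrr.
split=> [/ae0|h].
  by apply: filterS => x /[apply] /= -[] /gP.
apply: ae1; apply: filterS h => x /[apply] /gP /= ->.
by [].
Qed.

End ClippedIntegral.

(** * Signs of the bearing constants and the optimality certificate *)

Section LinearAlgebra.
Variable R : realType.

Lemma full_col_rank_inj m n (A : 'M[R]_(m, n)) (h : 'cV[R]_n) :
  \rank A = n -> A *m h = 0 -> h = 0.
Proof.
move=> rA Ah; apply: trmx_inj; rewrite trmx0.
have fA : row_free A^T by rewrite /row_free mxrank_tr rA.
by apply: (row_free_inj fA); rewrite mul0mx -trmx_mul Ah trmx0.
Qed.

Lemma sum_delta n (j : 'I_n) : \sum_i (delta_mx j 0 : 'cV[R]_n) i 0 = 1.
Proof.
rewrite (bigD1 j) //= mxE !eqxx big1 ?addr0 // => i ij.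
by rewrite mxE (negbTE ij).
Qed.

(** The bearing constants are indexed by positions in an enumeration of a set of
    shapelets; extending them to all shapelets allows sums over subsets. *)
Definition extend_zero (I : finType) (A : {set I}) (w : 'cV[R]_#|A|) (l : I) : R :=
  \sum_(r < #|A| | enum_val r == l) w r 0.

Lemma extend_zeroE (I : finType) (A : {set I}) (w : 'cV[R]_#|A|) r :
  extend_zero w (enum_val r) = w r 0.
Proof.
rewrite /extend_zero (big_pred1 r) // => r'.
by apply/eqP/eqP => [/enum_val_inj|->].
Qed.

Lemma sum_extend_zero (I : finType) (A : {set I}) (w : 'cV[R]_#|A|) (F : I -> R) :
  \sum_(r < #|A|) F (enum_val r) * w r 0 = \sum_(l in A) F l * extend_zero w l.
Proof.
rewrite [RHS]big_enum_val /=; apply: eq_bigr => r _.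
by rewrite extend_zeroE.
Qed.

Lemma sum_bool_eq1 (I : finType) (b : I -> bool) :
  \sum_i (b i)%:R = 1 :> R -> exists2 i, b i & forall j, b j -> j = i.
Proof.
rewrite -natr_sum -[1]/(1%:R) => /eqP; rewrite eqr_nat.
rewrite -big_mkcond sum1_card => /card1P[i bi].
exists i => [|j bj]; first by have := bi i; rewrite -!topredE /= eqxx.
by have := bi j; rewrite -!topredE /= bj => /esym/eqP.
Qed.

End LinearAlgebra.

Section Certificate.
Variables (R : realType) (d : nat).
Local Notation V := 'rV[R]_d.+1.
Variables (D : set V) (np nm : nat) (S : 'I_(np + nm) -> set V).
Local Notation B := (bearing D S).
Local Notation L := 'I_#|constructors D S|.
Implicit Types (l : L) (a : 'cV[R]_nm).

Lemma bearing_mulE (h : 'cV[R]_(np + nm)) l :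
  (B *m h) l 0 = (lsubmx B *m usubmx h) l 0 + (rsubmx B *m dsubmx h) l 0.
Proof. by rewrite -{1}[B]hsubmxK -{1}[h]vsubmxK mul_row_col mxE. Qed.

Lemma plus_mulE (h : 'cV[R]_np) l :
  (lsubmx B *m h) l 0 = \sum_j (constructor l (lshift nm j))%:R * h j 0.
Proof. by rewrite mxE; apply: eq_bigr => j _; rewrite !mxE. Qed.

Lemma minus_mulE (h : 'cV[R]_nm) l :
  (rsubmx B *m h) l 0 = \sum_j (constructor l (rshift np j))%:R * h j 0.
Proof. by rewrite mxE; apply: eq_bigr => j _; rewrite !mxE. Qed.

Lemma N_minusP l :
  reflect (exists j : 'I_nm, constructor l (rshift np j)) (l \in N_minus D S).
Proof.
rewrite inE; apply: (iffP existsP) => [[j /andP[]]|[j lj]]; last first.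
  by exists (rshift np j); rewrite !inE lj /= leq_addr.
rewrite inE => npj lj; case: (split_ordP j) => i ji; last by exists i; rewrite -ji.
by move: npj; rewrite ji /= leqNgt ltn_ord.
Qed.

Lemma N_plusP l :
  reflect (exists j : 'I_np, constructor l (lshift nm j)) (l \in N_plus D S).
Proof.
rewrite inE; apply: (iffP existsP) => [[j /andP[]]|[j lj]]; last first.
  by exists (lshift nm j); rewrite !inE lj /= ltn_ord.
rewrite inE => npj lj; case: (split_ordP j) => i ji; first by exists i; rewrite -ji.
by move: npj; rewrite ji /= ltnNge leq_addr.
Qed.

Lemma minus_mul_eq0 l (h : 'cV[R]_nm) : l \notin N_minus D S ->
  (rsubmx B *m h) l 0 = 0.
Proof.
move=> lM; rewrite minus_mulE big1 // => j _.
by case lj: (constructor _ _); rewrite ?mul0r //; case/N_minusP: lM; exists j.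
Qed.

(** A row of the bearing matrix with entry sum 1 over the added shapes and entries
    0 over the subtracted ones is a unit vector. *)
Lemma Gamma1RP l : l \in Gamma1R D S ->
  l \notin N_minus D S /\ exists2 j : 'I_np, constructor l (lshift nm j) &
    forall i, constructor l i -> i = lshift nm j.
Proof.
rewrite inE finset.in_setD => /andP[/andP[lM _] /eqP l1]; split => //.
have [j lj uj] : exists2 j : 'I_np, constructor l (lshift nm j) &
    forall i, constructor l (lshift nm i) -> i = j.
  apply: (@sum_bool_eq1 R); rewrite -[RHS]l1 plus_mulE.
  by apply: eq_bigr => j _; rewrite mxE mulr1.
exists j => // i; case: (split_ordP i) => i' -> li'; first by rewrite (uj i').
by case/negP: lM; apply/N_minusP; exists i'.
Qed.

Lemma Gamma1R_mulE l (h : 'cV[R]_(np + nm)) (j : 'I_np) :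
  l \in Gamma1R D S -> constructor l (lshift nm j) ->
  (B *m h) l 0 = h (lshift nm j) 0.
Proof.
move=> /Gamma1RP[_ [i li ui]] lj; have ij : j = i by apply: lshift_inj (ui _ lj).
rewrite mxE (bigD1 (lshift nm j)) //= mxE lj mul1r big1 ?addr0 // => i' i'j.
rewrite mxE; case li': (constructor l i'); last by rewrite mul0r.
by case/eqP: i'j; rewrite ij (ui _ li').
Qed.

Lemma Gamma1R_inj l l' i : l \in Gamma1R D S -> l' \in Gamma1R D S ->
  constructor l i -> constructor l' i -> l = l'.
Proof.
move=> /Gamma1RP[_ [j lj uj]] /Gamma1RP[_ [j' lj' uj']] li l'i.
apply: enum_val_inj; apply/ffunP => m; rewrite -!/(constructor _).
have jj' : lshift nm j = lshift nm j' by rewrite -(uj _ li) -(uj' _ l'i).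
apply/idP/idP => [/uj->|/uj'->]; [by rewrite jj'|by rewrite -jj'].
Qed.

Lemma Gamma0R_minus a l : l \in Gamma0R D S a -> l \in N_minus D S.
Proof. by rewrite /Gamma0R inE => /andP[]. Qed.

Lemma Gamma0R_mul_alphaR a l : l \in Gamma0R D S a -> (B *m alphaR np a) l 0 = 0.
Proof.
by rewrite inE bearing_mulE col_mxKu col_mxKd addrC => /andP[_ /eqP].
Qed.

Lemma Gamma1R_mul_alphaR a l : l \in Gamma1R D S -> (B *m alphaR np a) l 0 = 1.
Proof.
rewrite inE finset.in_setD => /andP[/andP[lM _] /eqP l1].
by rewrite bearing_mulE col_mxKu col_mxKd l1 minus_mul_eq0 // addr0.
Qed.

Lemma lp_feasible_mul_alphaR a l : lp_feasible D S a -> l \in N_minus D S ->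
  (B *m alphaR np a) l 0 <= 0.
Proof.
move=> fa /fa; rewrite bearing_mulE col_mxKu col_mxKd.
by lra.
Qed.

Lemma DeltaR_mulE a (h : 'cV[R]_nm) r :
  (DeltaR D S a *m h) r 0 = (rsubmx B *m h) (enum_val r) 0.
Proof. by rewrite !mxE; apply: eq_bigr => j _; rewrite !mxE. Qed.

(** The definition of a basic composition provides some maximizer; it is the only
    one.  Its positive dual solution v bounds the sum of the entries of every
    feasible point, with equality only if all the constraints of Gamma_0 are
    tight, and these determine the point because Delta has full column rank. *)
Lemma basic_maximizer a : basic D S -> lp_maximizer D S a ->
  [/\ \rank (DeltaR D S a) = nm, #|Gamma0R D S a| = nm &
      exists v : 'cV[R]_(#|Gamma0R D S a|),
        (DeltaR D S a)^T *m v = Defs.col1 /\ forall r, 0 < v r 0].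
Proof.
move=> [a' [[fa' ma'] rk card [v [vE v0]]]] [fa ma].
suff -> : a = a' by split=> //; exists v.
have sumE (b : 'cV[R]_nm) : \sum_j b j 0 = \sum_r v r 0 * (DeltaR D S a' *m b) r 0.
  have <- : ((Defs.col1 : 'cV[R]_nm)^T *m b) 0 0 = \sum_j b j 0.
    by rewrite mxE; apply: eq_bigr => j _; rewrite !mxE mul1r.
  rewrite -vE trmx_mul trmxK -mulmxA mxE; apply: eq_bigr => r _.
  by rewrite !mxE.
have tight r : (DeltaR D S a' *m a) r 0 <= (DeltaR D S a' *m a') r 0.
  have := enum_valP r; rewrite inE => /andP[rM /eqP r0].
  by rewrite !DeltaR_mulE; have := fa _ rM; lra.
have gap0 : \sum_r v r 0 * ((DeltaR D S a' *m a') r 0 - (DeltaR D S a' *m a) r 0) = 0.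
  apply/eqP; rewrite eq_le sumr_ge0 ?andbT => [|r _]; last first.
    by rewrite mulr_ge0 ?subr_ge0 // ltW.
  under eq_bigr do rewrite mulrBr.
  by rewrite sumrB -!sumE subr_le0; exact: ma.
apply/eqP; rewrite eq_sym -subr_eq0; apply/eqP; apply: (full_col_rank_inj rk).
apply/colP => r; rewrite mulmxBr.
have /eqP := gap0; rewrite psumr_eq0 => [/allP/(_ r)|r' _]; last first.
  by rewrite mulr_ge0 ?subr_ge0 // ltW.
rewrite mem_index_enum mulf_eq0 (gt_eqF (v0 r)) /= => /(_ isT) /eqP.
by rewrite !mxE.
Qed.

Variable a : 'cV[R]_nm.
Hypotheses (basicS : basic D S) (maxa : lp_maximizer D S a).
Variable w : 'cV[R]_#|Gamma01R D S a|.
Hypothesis wE : bearing_constants w.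
Local Notation wt := (extend_zero w).

Lemma sum_Gamma01R (F : L -> R) : \sum_(l in Gamma01R D S a) F l =
  \sum_(l in Gamma0R D S a) F l + \sum_(l in Gamma1R D S) F l.
Proof.
rewrite -bigU /=; first by apply: eq_bigl => l; rewrite finset.in_setU.
rewrite disjoint_subset.
apply/fintype.subsetP => l /Gamma0R_minus lM; rewrite inE; apply/negP.
by move=> /Gamma1RP[/negP].
Qed.

(** The linear system that defines the bearing constants, paired with a vector
    h: the right-hand side becomes the pairing of h with the signs of alphaR. *)
Lemma bearing_constants_sum (h : 'cV[R]_(np + nm)) :
  \sum_(l in Gamma01R D S a) (B *m h) l 0 * wt l =
  - (\sum_j usubmx h j 0 - \sum_j dsubmx h j 0).
Proof.
rewrite -sum_extend_zero.
transitivity ((h^T *m ((rows (Gamma01R D S a) B)^T *m w)) 0 0).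
  rewrite mulmxA -trmx_mul mxE; apply: eq_bigr => r _; congr (_ * _).
  by rewrite !mxE; apply: eq_bigr => j _; rewrite !mxE.
rewrite wE mxE big_split_ord /= opprB addrC -sumrN; congr (_ + _).
  by apply: eq_bigr => j _; rewrite [X in _ * X]mxE col_mxEd !mxE opprK mulr1.
by apply: eq_bigr => j _; rewrite [X in _ * X]mxE col_mxEu !mxE mulrN1.
Qed.

Lemma bearing_constants_plus (j : 'I_np) :
  \sum_(l in Gamma01R D S a) (constructor l (lshift nm j))%:R * wt l = -1.
Proof.
have := bearing_constants_sum (col_mx (delta_mx j 0) 0).
rewrite col_mxKu col_mxKd sum_delta [X in _ - X]big1 ?subr0 => [<-|i _]; last by rewrite mxE.
apply: eq_bigr => l _; rewrite bearing_mulE col_mxKu col_mxKd mulmx0 -colE.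
by rewrite !mxE addr0.
Qed.

Lemma bearing_constants_minus (j : 'I_nm) :
  \sum_(l in Gamma0R D S a) (constructor l (rshift np j))%:R * wt l = 1.
Proof.
have := bearing_constants_sum (col_mx 0 (delta_mx j 0)).
rewrite col_mxKu col_mxKd sum_delta [X in X - _]big1 => [|i _]; last by rewrite mxE.
rewrite sub0r opprK sum_Gamma01R [X in _ + X]big1 => [|l l1]; last first.
  have [lM _] := Gamma1RP l1.
  by rewrite bearing_mulE col_mxKu col_mxKd minus_mul_eq0 // mulmx0 !mxE addr0 mul0r.
rewrite addr0 => h; rewrite -[RHS]h; apply: eq_bigr => l _.
by rewrite bearing_mulE col_mxKu col_mxKd mulmx0 -colE !mxE add0r.
Qed.

(** By the previous equation the restriction of w to Gamma_0 solves the dual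
    system, so it is its unique solution, which is positive. *)
Lemma bearing_constants_Gamma0_gt0 l : l \in Gamma0R D S a -> 0 < wt l.
Proof.
have [rk card [v [vE v0]]] := basic_maximizer basicS maxa.
move=> l0; pose w0 : 'cV[R]_#|Gamma0R D S a| := \col_r wt (enum_val r).
suff w0v : w0 = v.
  by have := v0 (enum_rank_in l0 l); rewrite -w0v mxE enum_rankK_in.
have rkT : \rank (DeltaR D S a)^T = #|Gamma0R D S a| by rewrite mxrank_tr rk.
apply/eqP; rewrite -subr_eq0; apply/eqP; apply: (full_col_rank_inj rkT).
apply/eqP; rewrite mulmxBr vE subr_eq0; apply/eqP/colP => j.
rewrite [RHS]mxE -(bearing_constants_minus j) big_enum_val mxE.
by apply: eq_bigr => r _; rewrite !mxE.
Qed.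

(** The added shape of l lies in no other shapelet of Gamma_1, so its equation
    says that w_l is - 1 minus a nonnegative combination of values on Gamma_0. *)
Lemma bearing_constants_Gamma1_lt0 l : l \in Gamma1R D S -> wt l < 0.
Proof.
move=> l1; have [_ [j lj _]] := Gamma1RP l1.
have := bearing_constants_plus j; rewrite sum_Gamma01R (bigD1 l l1) /= lj mul1r.
rewrite [X in _ + (_ + X)]big1 ?addr0 => [|l' /andP[l'1 l'l]]; last first.
  case l'j: (constructor _ _); last by rewrite mul0r.
  by rewrite (Gamma1R_inj l'1 l1 l'j lj) eqxx in l'l.
have : 0 <= \sum_(i in Gamma0R D S a) (constructor i (lshift nm j))%:R * wt i.
  by apply: sumr_ge0 => i /bearing_constants_Gamma0_gt0/ltW i0; rewrite mulr_ge0.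
lra.
Qed.

Hypothesis plus_covered :
  forall j : 'I_np, exists2 l, l \in Gamma1R D S & constructor l (lshift nm j).

(** The rows of Gamma_1 are unit vectors that reach every added shape, and Delta
    takes care of the subtracted ones. *)
Lemma Gamma01R_inj (h : 'cV[R]_(np + nm)) :
  (forall l, l \in Gamma01R D S a -> (B *m h) l 0 = 0) -> h = 0.
Proof.
move=> Bh; have hu : usubmx h = 0.
  apply/colP => j; rewrite !mxE; have [l l1 lj] := plus_covered j.
  by rewrite -(Gamma1R_mulE h l1 lj) Bh // finset.in_setU l1 orbT.
have [rk _ _] := basic_maximizer basicS maxa.
have hd : dsubmx h = 0.
  apply: (full_col_rank_inj rk); apply/colP => r; rewrite DeltaR_mulE [RHS]mxE.
  have := Bh (enum_val r); rewrite bearing_mulE hu mulmx0 mxE add0r.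
  by apply; rewrite finset.in_setU enum_valP.
by rewrite -[h]vsubmxK hu hd col_mx0.
Qed.

Lemma norm1_col_mx m n (x : 'cV[R]_m) (y : 'cV[R]_n) :
  norm1 (col_mx x y) = norm1 x + norm1 y.
Proof.
rewrite /norm1 big_split_ord /=; congr (_ + _); apply: eq_bigr => i _.
  by rewrite col_mxEu.
by rewrite col_mxEd.
Qed.

Hypothesis a_le0 : forall j, a j 0 <= 0.

(** The signs of alphaR form a subgradient of the 1-norm at alphaR. *)
Lemma norm1_alphaR_ge (h : 'cV[R]_(np + nm)) :
  norm1 (alphaR np a) + (\sum_j usubmx h j 0 - \sum_j dsubmx h j 0) <=
  norm1 (alphaR np a + h).
Proof.
rewrite -{3}[h]vsubmxK /alphaR add_col_mx !norm1_col_mx.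
move: (usubmx h) (dsubmx h) => x y.
have plus : norm1 (Defs.col1 : 'cV[R]_np) + \sum_j x j 0 <= norm1 (Defs.col1 + x).
  rewrite /norm1 -big_split /=; apply: ler_sum => j _.
  by rewrite !mxE normr1; exact: ler_norm.
have minus : norm1 a - \sum_j y j 0 <= norm1 (a + y).
  rewrite /norm1 -sumrB; apply: ler_sum => j _.
  by rewrite !mxE (ler0_norm (a_le0 j)) -opprD -normrN; exact: ler_norm.
lra.
Qed.

(** The weights w certify optimality: they combine the sign conditions on the
    shapelets into an inequality opposite to the one that the 1-norm gives.
    Strictness of the bound on the ratios kills h', and equality in the rest
    kills h. *)
Lemma certificate_unique k (g : L -> 'I_k -> R)
    (h : 'cV[R]_(np + nm)) (h' : 'cV[R]_k) :
  (forall l, l \in Gamma0R D S a -> (B *m h) l 0 + \sum_j g l j * h' j 0 <= 0) ->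
  (forall l, l \in Gamma1R D S -> 0 <= (B *m h) l 0 + \sum_j g l j * h' j 0) ->
  (forall j, `|\sum_(l in Gamma01R D S a) g l j * wt l| < 1) ->
  norm1 (col_mx (alphaR np a + h) h') <= norm1 (alphaR np a) ->
  h = 0 /\ h' = 0.
Proof.
move=> h0 h1 g1; rewrite norm1_col_mx => hnorm.
pose t l := ((B *m h) l 0 + \sum_j g l j * h' j 0) * wt l.
have t0 l : l \in Gamma01R D S a -> t l <= 0.
  rewrite finset.in_setU => /orP[l0|l1].
    by rewrite mulr_le0_ge0 ?h0 // ltW // bearing_constants_Gamma0_gt0.
  by rewrite mulr_ge0_le0 ?h1 // ltW // bearing_constants_Gamma1_lt0.
pose c j := \sum_(l in Gamma01R D S a) g l j * wt l.
have tE : \sum_(l in Gamma01R D S a) t l =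
    - (\sum_j usubmx h j 0 - \sum_j dsubmx h j 0) + \sum_j c j * h' j 0.
  rewrite -bearing_constants_sum; under eq_bigr do rewrite /t mulrDl.
  rewrite big_split /=; congr (_ + _).
  under eq_bigr do rewrite mulr_suml.
  rewrite exchange_big; apply: eq_bigr => j _; rewrite mulr_suml.
  by apply: eq_bigr => l _; rewrite mulrAC.
have ht0 : \sum_(l in Gamma01R D S a) t l <= 0 by exact: sumr_le0.
have ch : - \sum_j `|c j| * `|h' j 0| <= \sum_j c j * h' j 0.
  rewrite -sumrN; apply: ler_sum => j _; rewrite -normrM.
  by rewrite lerNl -normrN; exact: ler_norm.
have slack0 j : 0 <= (1 - `|c j|) * `|h' j 0|.
  by rewrite mulr_ge0 // subr_ge0; exact: ltW (g1 j).
have slackE : \sum_j (1 - `|c j|) * `|h' j 0| =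
    norm1 h' - \sum_j `|c j| * `|h' j 0|.
  by rewrite /norm1 -sumrB; apply: eq_bigr => j _; rewrite mulrBl mul1r.
have slack_ge0 : 0 <= \sum_j (1 - `|c j|) * `|h' j 0| by exact: sumr_ge0.
have normh := norm1_alphaR_ge h.
have slack_eq0 : \sum_j (1 - `|c j|) * `|h' j 0| = 0 by lra.
have t_eq0 : \sum_(l in Gamma01R D S a) t l = 0 by lra.
have h'0 : h' = 0.
  apply/colP => j; rewrite mxE; move/eqP: slack_eq0; rewrite psumr_eq0 //.
  move=> /allP/(_ j); rewrite mem_index_enum => /(_ isT).
  by rewrite mulf_eq0 subr_eq0 (gt_eqF (g1 j)) normr_eq0 /= => /eqP.
split => //; apply: Gamma01R_inj => l lG.
have /eqP : \sum_(l in Gamma01R D S a) - t l = 0 by rewrite sumrN t_eq0 oppr0.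
rewrite psumr_eq0 => [/allP/(_ l)|i /t0]; last by rewrite oppr_ge0.
rewrite mem_index_enum lG oppr_eq0 => /(_ isT).
rewrite /t big1 ?addr0 => [|j _]; last by rewrite h'0 mxE mulr0.
rewrite mulf_eq0 => /orP[/eqP//|wt0].
move: lG; rewrite finset.in_setU => /orP[/bearing_constants_Gamma0_gt0|/bearing_constants_Gamma1_lt0];
  by rewrite (eqP wt0) ltxx.
Qed.

End Certificate.

(** * Shapelets of a non-redundant composition *)

Section Linkage.
Variables (R : realType) (d : nat).
Local Notation V := 'rV[R]_d.+1.
Variables (D : set V) (np nm : nat) (S : 'I_(np + nm) -> set V).
Hypotheses (domD : imaging_domain D) (shS : forall j, is_shape D (S j)).
Hypothesis nonred : nonredundant D S (I_plus np nm) (I_minus np nm).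

Lemma in_I_plus (j : 'I_np) : lshift nm j \in I_plus np nm.
Proof. by rewrite inE /= ltn_ord. Qed.

Lemma in_I_minus (j : 'I_nm) : rshift np j \in I_minus np nm.
Proof. by rewrite inE /= leq_addr. Qed.

Lemma signature_neq0 x j : S j x -> signature S x != [ffun=> false].
Proof.
move=> Sx; apply/eqP => /ffunP/(_ j); rewrite [RHS]ffunE.
by move/(introT (signatureP S x j)): Sx => ->.
Qed.

(** Removing the added shape j changes the composition, so some shapelet lies in
    that shape and in no other shape of the composition. *)
Lemma Gamma1R_covers (j : 'I_np) :
  exists2 l, l \in Gamma1R D S & constructor l (lshift nm j).
Proof.
have [x [gx Sx only]] := nonredundant_plus domD shS nonred (in_I_plus j).
have [l lx] := generic_constructor shS gx (signature_neq0 Sx).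
have onlyl i : constructor l i -> i = lshift nm j.
  rewrite lx => /signatureP Si; apply/eqP/negPn/negP => ij.
  apply: only ij Si; rewrite finset.in_setU.
  by case: (split_ordP i) => i' ->; rewrite ?in_I_plus ?in_I_minus ?orbT.
have lj : constructor l (lshift nm j) by rewrite lx; apply/signatureP.
exists l => //; rewrite inE finset.in_setD; apply/andP; split; first (apply/andP; split).
- by apply/negP => /N_minusP[i /onlyl/eqP]; rewrite eq_rlshift.
- by apply/N_plusP; exists j.
rewrite plus_mulE (bigD1 j) //= lj mxE mulr1 big1 ?addr0 // => i ij.
case li: (constructor _ _); last by rewrite mul0r.
by rewrite (lshift_inj (onlyl _ li)) eqxx in ij.
Qed.

(** Some shapelet lies in the subtracted shape j and in no other subtracted
    one; its constraint reads alpha_j + (a nonnegative number) <= 0. *)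
Lemma lp_feasible_le0 (a : 'cV[R]_nm) j : lp_feasible D S a -> a j 0 <= 0.
Proof.
move=> fa; have [x [gx Sx only]] := nonredundant_minus domD shS nonred (in_I_minus j).
have [l lx] := generic_constructor shS gx (signature_neq0 Sx).
have lj : constructor l (rshift np j) by rewrite lx; apply/signatureP.
have := fa l; rewrite minus_mulE (bigD1 j) //= lj mul1r big1 => [|i ij]; last first.
  case li: (constructor _ _); last by rewrite mul0r.
  move: li; rewrite lx => /signatureP Si; case: (only _ (in_I_minus i)) => //.
  by rewrite (inj_eq (@rshift_inj _ _)).
rewrite addr0; have -> : l \in N_minus D S by apply/N_minusP; exists j.
move=> /(_ isT)/le_trans; apply; rewrite oppr_le0 plus_mulE sumr_ge0 // => i _.
by rewrite mxE mulr1.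
Qed.

(** A constructor is nonzero, so a point in no subtracted shape lies in an added
    one. *)
Lemma generic_compositionP x l : constructor l = signature S x ->
  composition S (I_plus np nm) (I_minus np nm) x <-> l \notin N_minus D S.
Proof.
move=> lx; split=> [/compositionP[_ nM]|/N_minusP nM].
  apply/N_minusP => -[j]; rewrite lx => /signatureP; exact/nM/in_I_minus.
have nS i : S (rshift np i) x -> False.
  by move=> Si; apply: nM; exists i; rewrite lx; exact/signatureP.
apply/compositionP; split; last first.
  move=> i; case: (split_ordP i) => i' ->; last by move=> _; exact: nS.
  by rewrite inE /= leqNgt ltn_ord.
apply: contrapT => nP; have := enum_valP l; rewrite inE => /andP[/eqP l0 _].
apply: l0; apply/ffunP => i; rewrite [RHS]ffunE -/(constructor l) lx.
apply/negbTE/negP => /signatureP; case: (split_ordP i) => i' ->; last exact: nS.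
by move=> Si; apply: nP; exists (lshift nm i') => //; exact: in_I_plus.
Qed.

Lemma comb_bearing x l (h : 'cV[R]_(np + nm)) : constructor l = signature S x ->
  comb S h x = (bearing D S *m h) l 0.
Proof.
move=> lx; rewrite mxE; apply: eq_bigr => j _; rewrite mxE lx mulrC ffunE.
by rewrite indicE; case: asboolP => Sx; [rewrite mem_set|rewrite memNset].
Qed.

Variable a : 'cV[R]_nm.
Hypothesis fa : lp_feasible D S a.

(** On the composition the value counts the added shapes that contain the point;
    elsewhere it is bounded by a constraint of the linear program, or zero. *)
Lemma comb_alphaR_lucid x : generic D S x ->
  if `[< composition S (I_plus np nm) (I_minus np nm) x >]
  then 1 <= comb S (alphaR np a) x else comb S (alphaR np a) x <= 0.
Proof.
move=> gx; have [x0|x0] := eqVneq (signature S x) [ffun=> false].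
  have nS j : ~ S j x by move/signature_neq0; rewrite x0 eqxx.
  have -> : comb S (alphaR np a) x = 0.
    by rewrite /comb big1 // => j _; rewrite indicE memNset // mulr0.
  by case: asboolP => // /compositionP[[j _ /nS]].
have [l lx] := generic_constructor shS gx x0; rewrite (comb_bearing _ lx).
case: asboolP => [cx|/(generic_compositionP lx)/negP/negPn lM]; last first.
  exact: lp_feasible_mul_alphaR.
have lM := (generic_compositionP lx).1 cx.
rewrite bearing_mulE col_mxKu col_mxKd minus_mul_eq0 // addr0 plus_mulE.
have [[j Pj Sj] nM] := (compositionP S _ _ x).1 cx.
have [j' jj'] : exists j', j = lshift nm j'.
  case: (split_ordP j) => j' jj'; first by exists j'.
  by case: (nM j) => //; rewrite jj'; exact: in_I_minus.
rewrite (bigD1 j') //= lx -jj'; move/(introT (signatureP S x j)): Sj => ->.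
rewrite mxE mulr1 lerDl sumr_ge0 // => i _; by rewrite mxE mulr1.
Qed.

End Linkage.

(** * Cells of the dictionary *)

Section Cells.
Variables (R : realType) (d : nat).
Local Notation V := 'rV[R]_d.+1.
Variables (D : set V) (np nm k : nat) (S : 'I_(np + nm + k) -> set V).
Variables (nO : nat) (Omega : 'I_nO -> set V).
Hypotheses (domD : imaging_domain D) (cells : cell_family D Omega).
Hypothesis dict : dictionary D S Omega.
Local Notation S1 := (first_shapes S).
Local Notation S2 := (last_shapes S).
Local Notation cellsOf l := (@cells_of R d D np nm k S nO Omega l).

Definition cell_overlaps : set V :=
  \bigcup_(p : 'I_nO * 'I_nO)
    (if p.1 == p.2 then set0 else Omega p.1 `&` Omega p.2).

Lemma null_cell_overlaps : null cell_overlaps.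
Proof.
apply: null_bigcup => -[i i'] /=; case: eqP => [_|/eqP ii'].
  exact: negligible_set0.
by have [_] := cells; apply.
Qed.

(** A shape is a union of cells; a point that lies in only one cell lies in the
    shape only if that cell is one of them. *)
Lemma in_cellP i x j : Omega i x -> ~ cell_overlaps x ->
  S j x <-> Omega i `<=` S j.
Proof.
move=> ix nx; split=> [|/(_ x)]; last exact.
have [_ /(_ j)[A ->] _] := dict; move=> [i' Ai' i'x].
suff -> : i = i' by move=> y i'y; exists i'.
apply/eqP/negPn/negP => ii'; apply: nx; exists (i, i') => //=.
by rewrite (negbTE ii').
Qed.

Lemma first_shapes_shape j : is_shape D (S1 j).
Proof. by have [h _ _] := dict; exact: h. Qed.

Lemma cell_generic i N : null N ->
  exists x, [/\ Omega i x, generic D S1 x, ~ cell_overlaps x & ~ N x].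
Proof.
move=> N0; have [/(_ i) shi _] := cells; apply: contrapT => none.
apply: (shape_not_null domD shi).
have := negligibleU (negligibleU N0 null_cell_overlaps) (null_boundaries first_shapes_shape).
apply: negligibleS => x ix; apply: contrapT => /not_orP[/not_orP[Nx ox] bx].
apply: none; exists x; split => //; split; first exact: shape_sub ix.
by move=> j bj; apply: bx; exists j.
Qed.

Lemma cells_ofP l i x : i \in cellsOf l -> Omega i x -> generic D S1 x ->
  constructor l = signature S1 x.
Proof.
by rewrite inE => /asboolP il ix gx; apply: (generic_dsd first_shapes_shape gx); exact: il.
Qed.

(** A generic point of the shapelet lies in a single cell, which has the same
    position as the point with respect to every shape. *)
Lemma cells_of_neq0 (l : 'I_#|constructors D S1|) : (0 < #|cellsOf l|)%N.
Proof.
have [x [gx lx nx]] := shapelet_generic domD first_shapes_shape l null_cell_overlaps.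
have [j Sj] : exists j, S1 j x.
  apply: contrapT => nS; have := enum_valP l; rewrite inE => /andP[/eqP l0 _].
  apply: l0; apply/ffunP => j; rewrite [RHS]ffunE -/(constructor l) lx.
  by apply/negbTE/negP => /signatureP Sj; apply: nS; exists j.
have [i ix] : exists i, Omega i x.
  have [_ /(_ (lshift k j))[A SA] _] := dict.
  by move: Sj; rewrite /first_shapes SA => -[i _ ix]; exists i.
apply/card_gt0P; exists i; rewrite inE; apply/asboolP => y iy m _.
rewrite lx; case: ifPn => /signatureP Sm.
  exact: ((in_cellP (lshift k m) ix nx).1 Sm) iy.
have [/(_ i) [iD _ _ icl _] _] := cells.
apply: cl_in_near; [exact: subDsetl|exact: iD|move=> W yW].
have intD : int_in D (Omega i) `<=` D by move=> z /int_in_sub/iD.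
move: iy; rewrite icl => cly.
have [z iz zW] := cl_inP intD cly (filterS (fun z h _ => h) (nbhs_interior yW)).
have Dz := intD _ iz.
have [|u [Du [Wu iu] nu]] := @conull_dense _ _ D domD _ z
  (fun u => W u /\ Omega i u) null_cell_overlaps Dz.
  apply: filterS (filterI zW ((int_inP _ Dz).1 iz)) => u [h1 h2] Du.
  by split; [exact: h1|exact: h2].
exists u; split => //; split => // Su; apply: Sm.
by apply/(in_cellP (lshift k m) ix nx)/(in_cellP (lshift k m) iu nu).
Qed.

Lemma comb_cell l i x (b1 : 'cV[R]_(np + nm)) (b2 : 'cV[R]_k) :
  i \in cellsOf l -> Omega i x -> generic D S1 x -> ~ cell_overlaps x ->
  comb S (col_mx b1 b2) x =
  (bearing D S1 *m b1) l 0 + \sum_j incidence Omega S2 j i * b2 j 0.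
Proof.
move=> il ix gx nx; rewrite /comb big_split_ord /=; congr (_ + _).
  rewrite -(comb_bearing _ (cells_ofP il ix gx)).
  by apply: eq_bigr => j _; rewrite col_mxEu.
apply: eq_bigr => j _; rewrite col_mxEd mxE mulrC indicE; congr ((nat_of_bool _)%:R * _).
apply/idP/asboolP => [|h]; first by rewrite inE => /(in_cellP _ ix nx).
by apply/mem_set/(in_cellP _ ix nx).
Qed.

(** Averaging the values on the cells of a shapelet replaces the incidences by
    the ratios gamma; this is where shapelets have to contain cells. *)
Lemma sum_cell_ratio l (f : R) (b2 : 'cV[R]_k) :
  \sum_(i in cellsOf l) (f + \sum_j incidence Omega S2 j i * b2 j 0) =
  #|cellsOf l|%:R * (f + \sum_j @cell_ratio R d D np nm k S nO Omega l j * b2 j 0).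
Proof.
rewrite big_split /= sumr_const mulrDr mulr_natl; congr (_ + _).
rewrite exchange_big mulr_sumr; apply: eq_bigr => j _.
rewrite -mulr_suml mulrA; congr (_ * _); rewrite /cell_ratio mulrCA divff ?mulr1 //.
by rewrite pnatr_eq0 -lt0n cells_of_neq0.
Qed.

End Cells.

(** * Unique minimizer *)

Theorem theorem4p10 (R : realType) (d : nat) (D : set 'rV[R]_d.+1)
    (Pin Pex : 'rV[R]_d.+1 -> R) (np nm k nO : nat)
    (S : 'I_(np + nm + k) -> set 'rV[R]_d.+1)
    (Omega : 'I_nO -> set 'rV[R]_d.+1)
    (adag : 'cV[R]_nm)
    (w : 'cV[R]_#|Gamma01R D (first_shapes S) adag|) :
  imaging_domain D ->
  (forall x, D x -> 0 <= Pin x /\ 0 <= Pex x) ->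
  leb.-integrable (D : set (lebV R d)) (EFin \o Pin) ->
  leb.-integrable (D : set (lebV R d)) (EFin \o Pex) ->
  cell_family D Omega ->
  dictionary D S Omega ->
  (0 < np)%N ->
  nonredundant D (first_shapes S) (I_plus np nm) (I_minus np nm) ->
  basic D (first_shapes S) ->
  LOC D Pin Pex
    (cl_in D (composition (first_shapes S) (I_plus np nm) (I_minus np nm))) ->
  lp_maximizer D (first_shapes S) adag ->
  bearing_constants w ->
  row_free (col_mx (bearing_cells1 D S Omega adag)
                   (bearing_cells2 D S Omega adag)) ->
  (forall j : 'I_k,
     `|\sum_(r < #|Gamma01R D (first_shapes S) adag|)
         cell_ratio Omega (enum_val r) j * w r 0| < 1) ->
  is_minimizer D Pin Pex S (norm1 (alphaR np adag))
    (col_mx (alphaR np adag) 0) /\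
  (forall a, is_minimizer D Pin Pex S (norm1 (alphaR np adag)) a ->
     a = col_mx (alphaR np adag) 0).
Proof.
move=> domD _ iPin iPex cells dict _ nonred bas [locin locout] maxa wE _ ratio.
have shS j : is_shape D (S j) by have [h _ _] := dict; exact: h.
have sh1 := first_shapes_shape dict.
have mD := measurable_domain domD.
have [fa _] := maxa.
pose u x := Pin x - Pex x.
have iu : leb.-integrable (D : set (lebV R d)) (EFin \o u).
  by apply: eq_integrable (integrableB mD iPin iPex).
pose optimal b := {ae leb, forall x, D x -> u x * comb S b x <= negpart u x}.
pose lower := \int[leb]_(x in (D : set (lebV R d))) negpart u x.
have mcomb b : measurable_fun (D : set (lebV R d)) (comb S b).
  apply: measurable_sum => j; apply: measurable_funM; first exact: measurable_cst.
  exact/measurable_indic/(measurable_shape domD).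
have comb_le b x : D x -> `|comb S b x| <= norm1 b.
  move=> _; apply: le_trans (ler_norm_sum _ _ _) _; apply: ler_sum => j _.
  by rewrite normrM ler_piMr // indicE; case: (x \in S j); rewrite ?normr1 ?normr0.
have lower_le b : lower <= objective D Pin Pex S b.
  exact: (clipped_ge mD iu (mcomb b) (@comb_le b)).
have optimalP b : objective D Pin Pex S b = lower <-> optimal b.
  exact: (clipped_eqP mD iu (mcomb b) (@comb_le b)).
pose comp := composition (first_shapes S) (I_plus np nm) (I_minus np nm).
have u_in x : generic D (first_shapes S) x -> comp x -> u x < 0.
  by move=> gx /(generic_composition sh1 _ _ gx)/locin; rewrite subr_lt0.
have u_out x : generic D (first_shapes S) x -> ~ comp x -> 0 < u x.
  move=> gx cx; rewrite subr_gt0; apply: locout; split; first by case: gx.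
  by move/(generic_composition sh1 _ _ gx).
pose astar : 'cV[R]_(np + nm + k) := col_mx (alphaR np adag) 0.
have combE x : comb S astar x = comb (first_shapes S) (alphaR np adag) x.
  rewrite /comb big_split_ord /= [X in _ + X]big1 ?addr0 => [|j _].
    by apply: eq_bigr => j _; rewrite col_mxEu.
  by rewrite col_mxEd mxE mul0r.
(* Off the boundaries the combination is at least 1 on the composition, where
   u < 0, and nonpositive elsewhere, where u > 0. *)
have astar_opt : objective D Pin Pex S astar = lower.
  apply/optimalP; apply: negligibleS (null_boundaries sh1) => x.
  apply: contra_notP => bx Dx; have gx : generic D (first_shapes S) x.
    by split=> // j bj; apply: bx; exists j.
  have := comb_alphaR_lucid sh1 fa gx; rewrite -combE /negpart.
  case: asboolP => [/(u_in _ gx) ux|/(u_out _ gx) ux] L1.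
    by case: (ltP (u x) 0) => ?; nra.
  by case: (ltP (u x) 0) => ?; nra.
split=> [|b [bnorm bmin]].
  split=> [|b _]; last by rewrite -/astar astar_opt.
  by rewrite norm1_col_mx [X in _ + X]/norm1 big1 ?addr0 // => j _; rewrite mxE normr0.
have b_opt : optimal b.
  apply/optimalP/eqP; rewrite eq_le lower_le andbT -astar_opt; apply: bmin.
  by rewrite norm1_col_mx [X in _ + X]/norm1 big1 ?addr0 // => j _; rewrite mxE normr0.
pose b1 := usubmx b; pose b2 := dsubmx b.
have bE : b = col_mx b1 b2 by rewrite vsubmxK.
(* No cell is null, so the almost everywhere condition holds at some generic
   point of each cell, and there it is a condition on the cell. *)
have cell_sign l i : i \in @cells_of R d D np nm k S nO Omega l ->
    let val := (bearing D (first_shapes S) *m b1) l 0 +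
      \sum_j incidence Omega (last_shapes S) j i * b2 j 0 in
    if l \in N_minus D (first_shapes S) then val <= 0 else 1 <= val.
  move=> il; have [x [ix gx nx]] := cell_generic domD cells dict i b_opt.
  move=> /contrapT/(_ (proj1 gx)) bx.
  rewrite -(comb_cell dict _ _ il ix gx nx) -bE.
  have lx := cells_ofP dict il ix gx; have cP := generic_compositionP lx.
  move: bx; rewrite /negpart; case: ifPn => lM.
    have /(u_out _ gx) ux : ~ comp x by move/cP; rewrite lM.
    by rewrite (min_idPr (ltW ux)) pmulr_rle0.
  have /(u_in _ gx) ux : comp x by exact/cP.
  by rewrite (min_idPl (ltW ux)) -{2}[u x]mulr1 ler_nM2l.
pose g (l : 'I_#|constructors D (first_shapes S)|) j : R :=
  @cell_ratio R d D np nm k S nO Omega l j.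
have shapelet_sign l : let val := (bearing D (first_shapes S) *m b1) l 0 +
      \sum_j g l j * b2 j 0 in
    if l \in N_minus D (first_shapes S) then val <= 0 else 1 <= val.
  have card0 : (0 < #|@cells_of R d D np nm k S nO Omega l|%:R :> R).
    by rewrite ltr0n (cells_of_neq0 domD cells dict).
  have := sum_cell_ratio domD cells dict l ((bearing D (first_shapes S) *m b1) l 0) b2.
  move=> sumE /=; case: ifPn => lM.
    rewrite -(pmulr_rle0 _ card0) -sumE; apply: sumr_le0 => i /cell_sign /=.
    by rewrite lM.
  rewrite -(ler_pM2l card0) -sumE mulr1 -sum1_card natr_sum.
  by apply: ler_sum => i /cell_sign /=; rewrite (negbTE lM).
have diffE l : (bearing D (first_shapes S) *m (b1 - alphaR np adag)) l 0 =
    (bearing D (first_shapes S) *m b1) l 0 -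
    (bearing D (first_shapes S) *m alphaR np adag) l 0.
  by rewrite mulmxBr !mxE.
have [] // := @certificate_unique R d D np nm (first_shapes S) adag bas maxa w wE
  _ _ k g (b1 - alphaR np adag) b2.
- exact: Gamma1R_covers.
- by move=> j; apply: lp_feasible_le0 fa.
- move=> l l0; have := shapelet_sign l; rewrite (Gamma0R_minus l0) /=.
  by rewrite diffE Gamma0R_mul_alphaR // subr0.
- move=> l l1; have := shapelet_sign l; have [/negbTE-> _] := Gamma1RP l1.
  by rewrite /= diffE Gamma1R_mul_alphaR //; lra.
- move=> j; rewrite -sum_extend_zero; exact: ratio.
- by rewrite addrC subrK -bE.
by move=> /eqP; rewrite subr_eq0 => /eqP b1E b20; rewrite bE b1E b20.
Qed.
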